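(* For all integers $n\ge 2$ and $r\ge 1$, the group $2V$ is not isomorphic to $V^+_{n,r}$ and is not isomorphic to $T^s_{n,r}$.
   Context: Definition of $2V$. Let $C\subset I=[0,1]$ be the standard middle-thirds Cantor set. A pattern is a finite set of rectangles in $I^2$ obtained from the trivial pattern $\{I^2\}$ by finitely many steps, where each step removes one rectangle $R$ of the pattern and replaces it by the two congruent rectangles obtained by dividing $R$ exactly in half by either a vertical or a horizontal line. Each rectangle $R$ occurring in a pattern corresponds to a closed and open subset $A(R)$ of $C\times C$, defined inductively: $A(I^2)=C\times C$; if $R$ is divided vertically into left half $R'$ and right half $R''$, then $A(R')$ and $A(R'')$ are the left third and right third of $A(R)$; if $R$ is divided horizontally into bottom half $R'$ and top half $R''$, then $A(R')$ and $A(R'')$ are the bottom third and top third of $A(R)$. (Here the thirds of $A(R)$ are its intersections with the corresponding closed thirds of the smallest closed rectangle containing $A(R)$.) A numbered pattern is a pattern with $m$ rectangles together with a bijection between $\{0,1,\ldots,m-1\}$ and its rectangles. If $P_1$ and $P_2$ are numbered patterns with the same number of rectangles, with rectangles $R_i$ and $T_i$ respectively (subscripts giving the numbering), then $h(P_1,P_2)$ is the self homeomorphism of $C\times C$ that takes each $A(R_i)$ onto $A(T_i)$ by the restriction of the unique map of the form $(x,y)\mapsto(a+3^jx,\,b+3^ky)$ ($a,b\in\mathbf{R}$, $j,k\in\mathbf{Z}$) carrying $A(R_i)$ onto $A(T_i)$. The group $2V$ is the set of all such $h(P_1,P_2)$ under composition. Definition of $V_{n,r}$, $V^+_{n,r}$,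 $T_{n,r}$, $T^s_{n,r}$, for integers $n\ge2$, $r\ge1$. Consider $r$ disjoint unit intervals, linearly ordered from left to right. The first pattern consists of these $r$ intervals; new patterns are obtained by finitely many steps, each subdividing one interval of a pattern into $n$ equal subintervals. Each interval in a pattern corresponds to a closed and open subset of the disjoint union of $r$ copies of the Cantor set: identify each copy with $\{0,\ldots,n-1\}^{\mathbf{N}}$, so that an interval of the $i$-th copy reached by a finite word $w$ in $\{0,\ldots,n-1\}$ (the $j$-th subinterval of an interval, counting from $0$ and from the left, being reached by appending $j$) corresponds to the set of infinite sequences in the $i$-th copy with prefix $w$. Given two patterns with the same number of intervals and a bijection $\sigma$ between their intervals, one obtains a self homeomorphism of the disjoint union of the $r$ Cantor sets, which sends the sequence $wz$ in copy $i$ to the sequence $w'z$ in copy $i'$ whenever $\sigma$ takes the interval given by $(i,w)$ to the interval given by $(i',w')$. The group of all such homeomorphisms is $V_{n,r}$ (Higman's group, elsewhere called $G_{n,r}$; in particular $V_{2,1}=V$ is Thompson's group $V$). $V^+_{n,r}$ denotes the commutator subgroup of $V_{n,r}$. $T_{n,r}$ is the subgroup of $V_{n,r}$ of those elements for which the bijection $\sigma$ preserves the cyclic order of the intervals induced by the left to right order, and $T^s_{n,r}$ denotes the second commutator (second derived) subgroup of $T_{n,r}$. (It is known that the groups $V^+_{n,r}$ and $T^s_{n,r}$ are infinite, simple and finitely presented.) *)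

(* Defs.v *)
From HB Require Import structures.
From mathcomp Require Import all_boot all_order perm all_algebra.
From mathcomp Require Import all_classical all_reals.

Set Implicit Arguments.
Unset Strict Implicit.
Unset Printing Implicit Defensive.
Import Order.TTheory GRing.Theory Num.Theory.
Local Open Scope classical_set_scope.

(* The groups below are sets of homeomorphisms.  Each is described by
   pointwise formulas that determine a map on the whole space and make it
   automatically bicontinuous, so they are realized inside the group of all
   bijections of the underlying set.  The product is composition. *)
Record selfbij (X : Type) := SelfBij {
  sbfun :> X -> X;
  sbinv : X -> X;
  sbfunK : cancel sbfun sbinv;
  sbinvK : cancel sbinv sbfun }.

Lemma selfbijP (X : Type) (f g : selfbij X) : f =1 g -> f = g.
Proof.
case: f g => [f f' fK f'K] [g g' gK g'K] /= /funext fg; subst g.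
have e : f' = g' by apply/funext => x; rewrite -{1}(g'K x) fK.
subst g'; congr SelfBij; exact: Prop_irrelevance.
Qed.

HB.instance Definition _ (X : Type) := gen_eqMixin (selfbij X).
HB.instance Definition _ (X : Type) := gen_choiceMixin (selfbij X).

Section SelfBijGroup.
Variable X : Type.
Implicit Types f g h : selfbij X.

Definition sb_one : selfbij X := @SelfBij X id id (frefl _) (frefl _).
Definition sb_inv f : selfbij X := SelfBij (@sbinvK X f) (@sbfunK X f).
Definition sb_mul f g : selfbij X :=
  SelfBij (can_comp (@sbfunK X f) (@sbfunK X g))
          (can_comp (@sbinvK X g) (@sbinvK X f)).

Fact sb_mulA : associative sb_mul. Proof. by move=> f g h; exact: selfbijP. Qed.
Fact sb_mul1 : left_id sb_one sb_mul. Proof. by move=> f; exact: selfbijP. Qed.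
Fact sb_mulr1 : right_id sb_one sb_mul. Proof. by move=> f; exact: selfbijP. Qed.
Fact sb_mulV : left_inverse sb_one sb_inv sb_mul.
Proof. by move=> f; apply: selfbijP => x /=; exact: sbfunK. Qed.
Fact sb_mulrV : right_inverse sb_one sb_inv sb_mul.
Proof. by move=> f; apply: selfbijP => x /=; exact: sbinvK. Qed.

HB.instance Definition _ :=
  isGroup.Build (selfbij X) sb_mulA sb_mul1 sb_mulr1 sb_mulV sb_mulrV.
End SelfBijGroup.

Section AbstractGroups.
Local Open Scope group_scope.

Definition derived (G : groupType) (H : set G) : set G :=
  smallest (fun K : set G => group_closed [in K])
    [set commg x y | x in H & y in H].

(* Isomorphism of the groups carried by the subgroups [A] and [B]. *)
Definition isomorphic (G K : groupType) (A : set G) (B : set K) : Prop :=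
  exists f : G -> K, set_bij A B f /\
    forall x y, A x -> A y -> f (x * y) = f x * f y.
End AbstractGroups.

Section TwoV.
Local Open Scope ring_scope.
Variable R : realType.

Fixpoint cantor_level (k : nat) : set R :=
  if k is k'.+1 then
    [set x / 3 | x in cantor_level k'] `|` [set (2 + x) / 3 | x in cantor_level k']
  else `[0, 1].

Definition cantor : set R := \bigcap_k cantor_level k.

Definition cantor_sq : set (R * R) := cantor `*` cantor.

Record rect := Rect { xlo : R; xhi : R; ylo : R; yhi : R }.

Definition pts (Q : rect) : set (R * R) :=
  `[xlo Q, xhi Q] `*` `[ylo Q, yhi Q].

(* The part of [Q] lying between the fractions [s] and [t] of its width
   (resp. height). *)
Definition xpart (s t : R) (Q : rect) : rect :=
  Rect (xlo Q + s * (xhi Q - xlo Q)) (xlo Q + t * (xhi Q - xlo Q))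
       (ylo Q) (yhi Q).
Definition ypart (s t : R) (Q : rect) : rect :=
  Rect (xlo Q) (xhi Q)
       (ylo Q + s * (yhi Q - ylo Q)) (ylo Q + t * (yhi Q - ylo Q)).

Definition unit_square : rect := Rect 0 1 0 1.
Definition left_half := xpart 0 (1 / 2).
Definition right_half := xpart (1 / 2) 1.
Definition bottom_half := ypart 0 (1 / 2).
Definition top_half := ypart (1 / 2) 1.

Inductive pattern : set rect -> Prop :=
| pattern_unit : pattern [set unit_square]
| pattern_vertical P Q : pattern P -> P Q ->
    pattern ((P `\ Q) `|` [set left_half Q; right_half Q])
| pattern_horizontal P Q : pattern P -> P Q ->
    pattern ((P `\ Q) `|` [set bottom_half Q; top_half Q]).

Definition numbered_pattern (m : nat) (P : 'I_m -> rect) : Prop :=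
  injective P /\ pattern (range P).

(* The smallest closed rectangle containing a nonempty bounded set. *)
Definition hull (S : set (R * R)) : rect :=
  Rect (inf (fst @` S)) (sup (fst @` S)) (inf (snd @` S)) (sup (snd @` S)).

(* [cantor_part Q S]: [S] is the clopen subset of the Cantor square that
   corresponds to the dyadic rectangle [Q]; halving [Q] cuts off thirds of [S].
   This is functional in [Q], since vertical and horizontal cuts commute. *)
Inductive cantor_part : rect -> set (R * R) -> Prop :=
| cantor_part_unit : cantor_part unit_square cantor_sq
| cantor_part_left Q S : cantor_part Q S ->
    cantor_part (left_half Q) (S `&` pts (xpart 0 (1 / 3) (hull S)))
| cantor_part_right Q S : cantor_part Q S ->
    cantor_part (right_half Q) (S `&` pts (xpart (2 / 3) 1 (hull S)))
| cantor_part_bottom Q S : cantor_part Q S ->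
    cantor_part (bottom_half Q) (S `&` pts (ypart 0 (1 / 3) (hull S)))
| cantor_part_top Q S : cantor_part Q S ->
    cantor_part (top_half Q) (S `&` pts (ypart (2 / 3) 1 (hull S))).

Definition triadic_map (a b : R) (j k : int) (p : R * R) : R * R :=
  (a + 3 ^ j * p.1, b + 3 ^ k * p.2).

(* [f] is the map determined by the numbered patterns [P1] and [P2]. *)
Definition is_h (m : nat) (P1 P2 : 'I_m -> rect)
    (f : selfbij (set_type cantor_sq)) : Prop :=
  forall i : 'I_m, exists (S T : set (R * R)) (a b : R) (j k : int),
    [/\ cantor_part (P1 i) S, cantor_part (P2 i) T,
        triadic_map a b j k @` S = T &
        forall p, S (val p) -> val (f p) = triadic_map a b j k (val p)].

Definition twoV : set (selfbij (set_type cantor_sq)) :=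
  [set f | exists (m : nat) (P1 P2 : 'I_m -> rect),
    [/\ numbered_pattern P1, numbered_pattern P2 & is_h P1 P2 f]].
End TwoV.

Arguments twoV R : clear implicits.

Section HigmanThompson.
Variables n r : nat.

(* An interval is the pair of the index of its copy and the word reaching it. *)
Definition interval_code : Type := 'I_r * seq 'I_n.

Definition cantor_copies : Type := 'I_r * (nat -> 'I_n).

(* The infinite sequence [w] followed by [z]. *)
Definition prepend (w : seq 'I_n) (z : nat -> 'I_n) : nat -> 'I_n :=
  fun k => nth (z (k - size w)) w k.

(* Patterns list their intervals from left to right. *)
Inductive interval_pattern : seq interval_code -> Prop :=
| interval_pattern_init : interval_pattern [seq (i, [::]) | i <- enum 'I_r]
| interval_pattern_split s1 i w s2 :
    interval_pattern (s1 ++ (i, w) :: s2) ->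
    interval_pattern (s1 ++ [seq (i, rcons w j) | j <- enum 'I_n] ++ s2).

Definition is_exchange (m : nat) (P Q : m.-tuple interval_code)
    (sigma : {perm 'I_m}) (f : selfbij cantor_copies) : Prop :=
  forall (i : 'I_m) (z : nat -> 'I_n),
    f ((tnth P i).1, prepend (tnth P i).2 z) =
    ((tnth Q (sigma i)).1, prepend (tnth Q (sigma i)).2 z).

Definition cyclically_ordered (m : nat) (a b c : 'I_m) : bool :=
  [|| (a < b < c)%N, (b < c < a)%N | (c < a < b)%N].

Definition preserves_cyclic_order (m : nat) (sigma : {perm 'I_m}) : Prop :=
  forall a b c : 'I_m, cyclically_ordered a b c ->
    cyclically_ordered (sigma a) (sigma b) (sigma c).

Definition HigmanV : set (selfbij cantor_copies) :=
  [set f | exists (m : nat) (P Q : m.-tuple interval_code) (sigma : {perm 'I_m}),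
    [/\ interval_pattern P, interval_pattern Q & is_exchange P Q sigma f]].

Definition HigmanT : set (selfbij cantor_copies) :=
  [set f | exists (m : nat) (P Q : m.-tuple interval_code) (sigma : {perm 'I_m}),
    [/\ interval_pattern P, interval_pattern Q,
        preserves_cyclic_order sigma & is_exchange P Q sigma f]].

Definition Vplus : set (selfbij cantor_copies) := derived HigmanV.

Definition Ts : set (selfbij cantor_copies) := derived (derived HigmanT).
End HigmanThompson.

Arguments HigmanV n r : clear implicits.
Arguments HigmanT n r : clear implicits.
Arguments Vplus n r : clear implicits.
Arguments Ts n r : clear implicits.

(* Main.v *)
Require Import Defs.
From mathcomp Require Import all_boot all_order all_algebra.
From mathcomp Require Import all_classical all_reals.
From mathcomp Require Import perm zify ring lra.

(** The two groups are told apart by a purely algebraic property of a group: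

      for every g there is N > 0 such that every h commuting with g^(2N)
      already commutes with g^N.

    The property passes to subgroups, so it is enough to prove it for a group
    containing V_{n,r}, and to refute it in 2V.

    It fails in 2V because an element of 2V can simulate a machine with a head
    moving over a tape, the two coordinates of the square being the two halves
    of the tape.  The element [head_map] runs through a block of zeros until it
    meets a one, turns, and runs back to the previous one.  On a block of k
    zeros closed by ones it has period exactly 2(k+1), on an open set, and all
    k occur.  Given N = k+1, the involution [flip_map] supported on one position
    of the head in such a block commutes with g^(2N), which is the identity
    there, but not with g^N, which moves the support off itself
    ([head_map_flip], [head_map_flip_half]).  That these maps and their products
    belong to 2V is [box_local_twoV]: a bijection that replaces prefixes of
    bounded length carries a suitable refinement of a uniform grid onto a finer
    uniform grid, and both are patterns.

    It holds in V_{n,r} because there the dynamics is tame.  Let g replace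
    prefixes of length at least D.  Follow a cylinder under g as long as its
    word has length at least D.  Every point lies in a cylinder that can be
    followed forever by g or forever by its inverse
    ([tracked_forever_dichotomy]), and such an orbit enters a cylinder e with
    word of length D that some g^m maps into itself, e w |-> e v w
    ([tracked_forever_cycle]).  As there are finitely many such e, one N serves
    as m for all of them: under f = g^N or its inverse every point falls into
    a cylinder mapped into itself by prefixing a word v
    ([acts_deep_attracted]).  Such an f has at most one fixed point in the
    cylinder, or is the identity on it, and near a fixed point of f^2 the germ
    of f is determined by that of f^2: if f prefixes v, then f^2 prefixes v v,
    and v is its first half ([fixes_half]).  If h commutes with f^2, it carries
    the germ of f^2 at the attracting point to the germ of f^2 at its image,
    hence the same for f; so h and f commute near the attracting point, and
    therefore on everything that is attracted to it
    ([attracted_commute]). *)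

Set Implicit Arguments.
Unset Strict Implicit.
Unset Printing Implicit Defensive.

Lemma sb_mulE X (f g : selfbij X) x : (f * g)%g x = f (g x).
Proof. by []. Qed.

Lemma sb_expE X (f : selfbij X) k x : (f ^+ k)%g x = iter k f x.
Proof. by elim: k => // k IH; rewrite expgS /= -IH. Qed.

Lemma derived_sub (G : groupType) (H K : set G) : group_closed [in K] ->
  (H `<=` K)%classic -> (derived H `<=` K)%classic.
Proof.
move=> Kgrp HK; apply: smallest_sub => // _ [x Hx [y Hy <-]].
have Kx : x \in K by rewrite inE; apply: HK.
have Ky : y \in K by rewrite inE; apply: HK.
have KM := group_closedM Kgrp; have KV := group_closedV Kgrp.
apply/set_mem; rewrite /commg /conjg.
by rewrite !KM ?KV ?KM.
Qed.

(** * Cylinders of infinite words *)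

Section Cylinders.
Variables n r : nat.

Local Notation code := (interval_code n r).
Local Notation point := (cantor_copies n r).
Local Notation stream := (nat -> 'I_n).

Implicit Types (c e : code) (s z : stream) (w u v : seq 'I_n) (x y : point).
Implicit Types (f g h : point -> point).

Definition level c := size c.2.
Definition ext c w : code := (c.1, c.2 ++ w).
Definition cyl c z : point := (c.1, prepend c.2 z).
Definition shift k s : stream := fun i => s (k + i).

Definition acts f c c' := forall z, f (cyl c z) = cyl c' z.

Lemma prepend_cat u v z : prepend (u ++ v) z = prepend u (prepend v z).
Proof.
apply/funext => i; rewrite /prepend nth_cat size_cat.
case: ltnP => h; first exact: set_nth_default.
by rewrite subnDA [RHS]nth_default.
Qed.

Lemma prepend_nil s : prepend [::] s = s.
Proof. by apply/funext => i; rewrite /prepend nth_nil subn0. Qed.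

Lemma prepend_shift s k : prepend (mkseq s k) (shift k s) = s.
Proof.
apply/funext => i; rewrite /prepend size_mkseq /shift.
case: (ltnP i k) => h; first by rewrite nth_mkseq.
by rewrite nth_default ?size_mkseq // subnKC.
Qed.

Lemma mkseqD s k l : mkseq s (k + l) = mkseq s k ++ mkseq (shift k s) l.
Proof. by rewrite /mkseq iotaD map_cat add0n -[k in iota k l]addn0 iotaDl -map_comp. Qed.

Lemma prepend_inj u v s z :
  size u = size v -> prepend u s = prepend v z -> u = v /\ s = z.
Proof.
move=> suv eq; have uv : u = v.
  apply: (@eq_from_nth _ (s 0)) => // i iu.
  move/(congr1 (@^~ i)): eq; rewrite /prepend.
  rewrite (set_nth_default (s 0)) // => ->.
  by rewrite (set_nth_default (s 0)) // -suv.
split=> //; apply/funext => i.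
move/(congr1 (@^~ (size u + i))): eq.
by rewrite /prepend -uv !nth_default ?leq_addr // addKn.
Qed.

Lemma ext_nil c : ext c [::] = c.
Proof. by case: c => i w; rewrite /ext cats0. Qed.

Lemma extA c u v : ext (ext c u) v = ext c (u ++ v).
Proof. by rewrite /ext /= catA. Qed.

Lemma level_ext c w : level (ext c w) = level c + size w.
Proof. by rewrite /level /= size_cat. Qed.

Lemma cyl_ext c w z : cyl (ext c w) z = cyl c (prepend w z).
Proof. by rewrite /cyl prepend_cat. Qed.

Lemma cyl_inj c e s z : level c = level e -> cyl c s = cyl e z -> c = e /\ s = z.
Proof.
by case: c e => [i u] [j v] suv [-> /(prepend_inj suv) [/= -> ->]].
Qed.

Lemma acts_ext f c e w : acts f c e -> acts f (ext c w) (ext e w).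
Proof. by move=> fce z; rewrite !cyl_ext fce. Qed.

Lemma acts_comp f g c d e : acts g c d -> acts f d e -> acts (f \o g) c e.
Proof. by move=> gcd fde z /=; rewrite gcd fde. Qed.

Lemma acts_iterS f k c d e :
  acts (iter k f) c d -> acts f d e -> acts (iter k.+1 f) c e.
Proof. by move=> gcd fde z /=; rewrite gcd fde. Qed.

Lemma acts_iterD f k l c d e :
  acts (iter k f) c d -> acts (iter l f) d e -> acts (iter (k + l) f) c e.
Proof. by move=> gcd fde z; rewrite addnC iterD gcd fde. Qed.

Lemma acts_inv f f' c e : cancel f f' -> acts f c e -> acts f' e c.
Proof. by move=> fK fce z; rewrite -fce fK. Qed.

Lemma acts_iterB f f' i j c d e : cancel f f' -> i <= j ->
  acts (iter j f) c d -> acts (iter i f) c e -> acts (iter (j - i) f') d e.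
Proof.
move=> fK ij fd fe z; rewrite -fe -fd.
have iK k : cancel (iter k f) (iter k f').
  by elim: k => // k IH y; rewrite iterSr iterS fK IH.
by rewrite -{2}(subnK ij) iterD iK.
Qed.

Hypothesis n_gt1 : 1 < n.

(** If one of two words were longer, its extra letter would have to equal the
    first letter of the tail [z], and over two letters [z] can be chosen to
    start differently. *)
Lemma acts_inj f c d e : acts f c d -> acts f c e -> d = e.
Proof.
pose a := Ordinal (ltnW n_gt1); pose b := Ordinal n_gt1.
have le d' e' : acts f c d' -> acts f c e' -> level e' <= level d'.
  move=> fd fe; rewrite leqNgt; apply/negP => lt.
  have E t : t = nth a e'.2 (level d').
    have /(congr1 (fun x : point => x.2 (level d'))) : cyl d' (fun _ => t) = cyl e' (fun _ => t).
      by rewrite -fd -fe.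
    rewrite /cyl /prepend /= nth_default // => ->.
    exact: set_nth_default.
  by have /(congr1 val) : a = b by rewrite (E a) [RHS](E b).
move=> fd fe; have eq : level d = level e by apply/eqP; rewrite eqn_leq !le.
by case: (@cyl_inj d e (fun _ => a) (fun _ => a) eq); rewrite -?fd -?fe.
Qed.

(** * Orbits of cylinders *)

Section Tracking.
Variable D : nat.

Definition acts_deep f := forall c, D <= level c -> exists c', acts f c c'.

(** The bound [D <= level e], stronger than [g ^ j] replacing a prefix on [c], is
    what lets the next application of [g] replace a prefix too, and makes the
    cylinders of level exactly [D], finitely many, the places where tracking
    can get lost. *)
Definition tracked g c T := forall j, j <= T ->
  exists2 e, D <= level e & acts (iter j g) c e.

Definition tracked_forever g c := forall T, tracked g c T.

Lemma tracked_leq g c T T' : T' <= T -> tracked g c T -> tracked g c T'.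
Proof. by move=> le tr j jT; apply: tr; apply: leq_trans le. Qed.

Lemma tracked_ext g c w T : tracked g c T -> tracked g (ext c w) T.
Proof.
move=> tr j /tr [e De ge]; exists (ext e w); last exact: acts_ext.
by rewrite level_ext (leq_trans De) // leq_addr.
Qed.

Lemma tracked_forever_iter g c e j : tracked_forever g c ->
  acts (iter j g) c e -> tracked_forever g e.
Proof.
move=> tr ge T i _; have [d Dd gd] := tr (i + j) (i + j) (leqnn _).
by exists d => // z; rewrite -ge -iterD.
Qed.

Section Deep.
Variable g : point -> point.
Hypothesis g_deep : acts_deep g.

(** Each application of [g] shortens a word by at most [D] letters. *)
Lemma tracked_deep T c : T.+1 * D <= level c -> tracked g c T.
Proof.
move=> le j jT; suff [e De ge] : exists2 e, (T.+1 - j) * D <= level e & acts (iter j g) c e.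
  by exists e => //; apply: leq_trans De; rewrite leq_pmull // subn_gt0 ltnS.
elim: j jT => [|j IH] jT; first by exists c; rewrite ?subn0.
have [e De ge] := IH (ltnW jT).
have D_le : D <= level e by apply: leq_trans De; rewrite leq_pmull // subn_gt0 ltnS ltnW.
have [e1 ge1] : exists e1, acts g (e.1, take D e.2) e1.
  by apply: g_deep; rewrite /level /= size_takel.
have eE : e = ext (e.1, take D e.2) (drop D e.2).
  by rewrite /ext /= cat_take_drop; case: (e).
exists (ext e1 (drop D e.2)); last first.
  by apply: (acts_iterS ge); rewrite {1}eE; apply: acts_ext.
rewrite level_ext size_drop subSS -/(level e).
have eq : T.+1 - j = (T - j).+1 by lia.
by rewrite eq mulSn in De; lia.
Qed.

(** When the larger cylinder [c] is lost, its word has just become too short, while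
    that of the smaller one is still long enough; they differ by one letter, so
    the latter has length exactly [D]. *)
Lemma untracked_exit c a T : D <= level c -> tracked g (ext c [:: a]) T ->
  ~ tracked g c T -> exists j e,
  [/\ j <= T, level e = D & acts (iter j g) (ext c [:: a]) e].
Proof.
move=> Dc; elim: T => [_ []|T IH tr ntr].
  by move=> j; rewrite leqn0 => /eqP ->; exists c.
have [trT|ntrT] := pselect (tracked g c T); last first.
  have [j [e [jT De ge]]] := IH (tracked_leq (leqnSn T) tr) ntrT.
  by exists j, e; split=> //; apply: leqW.
have [e De ge] := trT T (leqnn T).
have [e' ge'] := g_deep De.
have gSe' := acts_iterS ge ge'.
have [e'' De'' ge''] := tr T.+1 (leqnn _).
have eE := acts_inj ge'' (acts_ext [:: a] gSe').
exists T.+1, e''; split=> //; apply/eqP; rewrite eqn_leq De'' andbT.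
rewrite eE level_ext addn1 ltnNge; apply/negP => De'.
apply: ntr => j; rewrite leq_eqVlt => /predU1P[->|]; first by exists e'.
exact: trT.
Qed.

(** Take the largest tracked cylinder around a given one and apply
    [untracked_exit] to the next larger one. *)
Lemma tracked_min T c w : D <= level c + size w ->
   tracked g (ext c w) T -> level c <= D -> exists w' v,
   [/\ w = w' ++ v, tracked g (ext c w') T & exists j e,
  [/\ j <= T, level e = D & acts (iter j g) (ext c w') e]].
Proof.
elim/last_ind: w => [|w a IH] Dw tr cD.
  exists [::], [::]; split=> //; exists 0, c; rewrite ext_nil; split=> //.
  by move: Dw; rewrite addn0 => ?; apply/eqP; rewrite eqn_leq cD.
have [wD|Dw'] := ltnP (level c + size w) D.
  exists (rcons w a), [::]; rewrite cats0; split=> //.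
  exists 0, (ext c (rcons w a)); split=> //.
  by move: Dw; rewrite level_ext size_rcons; lia.
have [trw|ntrw] := pselect (tracked g (ext c w) T).
  have [w' [v [-> ? ?]]] := IH Dw' trw cD; exists w', (rcons v a).
  by rewrite -rcons_cat.
exists (rcons w a), [::]; rewrite cats0; split=> //.
rewrite -cats1 -extA; apply: untracked_exit; rewrite ?level_ext //.
by rewrite extA cats1.
Qed.

End Deep.

Definition code_of (t : 'I_r * D.-tuple 'I_n) : code := (t.1, tval t.2).

Lemma level_code_of t : level (code_of t) = D.
Proof. exact: size_tuple. Qed.

Lemma code_ofP e : level e = D -> exists t, e = code_of t.
Proof.
case: e => i w; rewrite /level /= => sw; exists (i, tcast sw (in_tuple w)).
by rewrite /code_of /= val_tcast.
Qed.

Section Cycles.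
Variable g : point -> point.
Hypothesis g_deep : acts_deep g.

(** The same as [tracked_min] for infinite orbits; the cylinder of level [D] that is
    reached inherits the tracking. *)
Lemma tracked_forever_min c : D <= level c -> tracked_forever g c ->
  exists j e w, [/\ level e = D, tracked_forever g e & acts (iter j g) c (ext e w)].
Proof.
case: c => i w; elim/last_ind: w => [|w a IH] Dc tr.
  exists 0, (i, [::]), [::]; rewrite ext_nil; split=> //.
  by apply/eqP; rewrite eqn_leq Dc andbT.
have [wD|Dw] := ltnP (size w) D.
  exists 0, (i, rcons w a), [::]; rewrite ext_nil; split=> //.
  by move: Dc; rewrite /level /= size_rcons; lia.
have [trw|ntrw] := pselect (tracked_forever g (i, w)).
  have [j [e [v [De tre ge]]]] := IH Dw trw; exists j, e, (rcons v a); split=> //.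
  by rewrite -(cats1 v) -extA -cats1; apply: (@acts_ext _ (i, w)).
move/existsNP: ntrw => [T ntr].
have trT : tracked g (ext (i, w) [:: a]) T by rewrite /ext /= cats1; apply: tr.
have [j [e [jT De ge]]] := @untracked_exit _ g_deep (i, w) a T Dw trT ntr.
rewrite /ext /= cats1 in ge; exists j, e, [::]; rewrite ext_nil; split=> //.
exact: tracked_forever_iter ge.
Qed.

Lemma tracked_forever_step e : level e = D -> tracked_forever g e ->
  exists j e' w,
  [/\ level e' = D, tracked_forever g e' & acts (iter j.+1 g) e (ext e' w)].
Proof.
move=> De tr; have [e1 De1 ge1] := tr 1 1 (leqnn 1).
have [j [e' [w [De' tre' ge']]]] :=
  tracked_forever_min De1 (tracked_forever_iter tr ge1).
by exists j, e', w; split=> //; rewrite -add1n; apply: acts_iterD ge1 ge'.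
Qed.

Lemma tracked_forever_next : exists phi : 'I_r * D.-tuple 'I_n -> 'I_r * D.-tuple 'I_n,
  forall t, tracked_forever g (code_of t) ->
  tracked_forever g (code_of (phi t)) /\
  exists j w, acts (iter j.+1 g) (code_of t) (ext (code_of (phi t)) w).
Proof.
suff /choice [phi phiP] : forall t, exists u : 'I_r * D.-tuple 'I_n,
  tracked_forever g (code_of t) ->
  tracked_forever g (code_of u) /\
  exists j w, acts (iter j.+1 g) (code_of t) (ext (code_of u) w) by exists phi.
move=> t.
have [tr|ntr] := pselect (tracked_forever g (code_of t)); last by exists t.
have [j [e [w [/code_ofP [u ->] tru gu]]]] :=
  tracked_forever_step (level_code_of t) tr.
by exists u => _; split=> //; exists j, w.
Qed.

(** [tracked_forever_next] leads from each cylinder of level [D] tracked forever to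
    another one, later in time, and there are finitely many of them.  So some
    [e] recurs: a positive power of [g] maps it into itself. *)
Lemma tracked_forever_cycle c : D <= level c -> tracked_forever g c ->
  exists J m e w v, [/\ 0 < m, level e = D, tracked_forever g e,
    acts (iter J g) c (ext e w) & acts (iter m g) e (ext e v)].
Proof.
move=> Dc /(tracked_forever_min Dc) [J0 [_ [w0 [/code_ofP [t ->] tr0 g0]]]].
have [phi phiP] := tracked_forever_next.
have fi k : tracked_forever g (code_of (iter k phi t)).
  by elim: k => //= k /phiP [].
have path i k : exists J w, k <= J /\
  acts (iter J g) (code_of (iter i phi t)) (ext (code_of (iter (k + i) phi t)) w).
  elim: k => [|k [J [w [kJ gJ]]]]; first by exists 0, [::]; rewrite ext_nil.
  have [_ [j [v gj]]] := phiP _ (fi (k + i)).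
  exists (J + j.+1), (v ++ w); split; first by lia.
  rewrite -extA; exact: acts_iterD gJ (acts_ext w gj).
pose N := #|{: 'I_r * D.-tuple 'I_n}|.
have /injectivePn [i [j ij eq]] :
  ~~ injectiveb (fun k : 'I_N.+1 => iter k phi t).
  by apply/negP => /injectiveP /leq_card; rewrite card_ord /N ltnn.
wlog {ij} ij : i j eq / i < j => [W|].
  by case: (ltngtP i j) ij => [ij _|ji _|/val_inj ->]; [apply: W ij|apply: W ji|rewrite eqxx].
have [m [z [jm gm]]] := path i (j - i).
have [J [w [_ gJ]]] := path 0 i.
rewrite subnK ?(ltnW ij) // -eq in gm.
rewrite addn0 /= in gJ.
exists (J0 + J), m, (code_of (iter i phi t)), (w ++ w0), z; split=> //.
- by apply: leq_trans jm; rewrite subn_gt0.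
- exact: level_code_of.
- by rewrite -extA; apply: acts_iterD g0 (acts_ext w0 gJ).
Qed.

End Cycles.

Lemma tracked_forever_bound g : exists K, forall e, level e = D ->
  tracked g e K -> tracked_forever g e.
Proof.
have /choice [k kP] : forall t, exists K : nat,
    tracked g (code_of t) K -> tracked_forever g (code_of t).
  move=> t; have [tr|/existsNP [K ntr]] := pselect (tracked_forever g (code_of t)).
    by exists 0.
  by exists K.
exists (\max_t k t) => _ /code_ofP [t ->] tr; apply: kP.
exact: tracked_leq (leq_bigmax t) tr.
Qed.

Section Invertible.
Variables g g' : point -> point.
Hypothesis gK : cancel g g'.

(** The backward orbit of [e] first retraces the forward orbit of [c], then
    continues with the backward orbit of [c]. *)
Lemma tracked_back c e j T : j <= T -> tracked g c T -> tracked g' c T ->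
  acts (iter j g) c e -> tracked g' e T.
Proof.
move=> jT tr tr' gce i iT.
have [ij|ji] := leqP i j.
  have [d Dd gd] := tr (j - i) (leq_trans (leq_subr _ _) jT).
  exists d => //; have := acts_iterB gK (leq_subr i j) gce gd.
  by rewrite subKn.
have g'ec : acts (iter j g') e c.
  by rewrite -[j in iter j]subn0; apply: (acts_iterB gK _ gce).
have [d Dd gd] := tr' (i - j) (leq_trans (leq_subr _ _) iT).
exists d => //; rewrite -(subnKC (ltnW ji)); exact: acts_iterD g'ec gd.
Qed.

Lemma tracked_forever_back c e j :
  acts (iter j g) c e -> tracked_forever g' e -> tracked_forever g' c.
Proof.
move=> gce tr; apply: (tracked_forever_iter tr (j := j)).
by rewrite -[j in iter j]subn0; apply: (acts_iterB gK _ gce).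
Qed.
End Invertible.

Lemma tracked_level g c T : tracked g c T -> D <= level c.
Proof. by move=> /(_ 0 (leq0n _)) [e De /(@acts_inj id c c _ (fun=> erefl)) ->]. Qed.

(** Let [K] bound the time within which a cylinder of level [D] is lost, forward or
    backward, if it is lost at all.  Take the largest cylinder around [x] that
    is tracked for [K] steps in both directions.  In one of the two directions
    it is also the largest, so that its orbit in that direction meets a cylinder
    [e] of level [D].  In the opposite direction [e] is tracked for at least [K]
    steps, hence forever, and so is the cylinder around [x]. *)
Lemma tracked_forever_dichotomy g g' x : cancel g g' -> cancel g' g ->
  acts_deep g -> acts_deep g' -> exists c s,
  [/\ x = cyl c s, D <= level c & tracked_forever g c \/ tracked_forever g' c].
Proof.
move=> gK g'K gD g'D; have [K1 bound1] := tracked_forever_bound g.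
have [K2 bound2] := tracked_forever_bound g'.
pose K := maxn K1 K2; pose L := K.+1 * D.
have LD : D <= L by rewrite leq_pmull.
have sL : D <= level (x.1, [::]) + size (mkseq x.2 L) by rewrite add0n size_mkseq.
have deep f : acts_deep f -> tracked f (ext (x.1, [::]) (mkseq x.2 L)) K.
  by move=> fD; apply: tracked_deep => //; rewrite level_ext size_mkseq.
have [w1 [v1 [eq1 tr1 [j1 [e1 [jK1 De1 ge1]]]]]] :=
  tracked_min gD sL (deep _ gD) (leq0n _).
have [w2 [v2 [eq2 tr2 [j2 [e2 [jK2 De2 ge2]]]]]] :=
  tracked_min g'D sL (deep _ g'D) (leq0n _).
have xE w v : mkseq x.2 L = w ++ v ->
    x = cyl (ext (x.1, [::]) w) (prepend v (shift L x.2)).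
  move=> eq; rewrite -cyl_ext extA -eq cyl_ext prepend_shift.
  by rewrite /cyl prepend_nil; case: (x).
have wP w v w' v' : w ++ v = w' ++ v' -> size w <= size w' -> w' = w ++ drop (size w) w'.
  move=> eq le; rewrite -{1}(cat_take_drop (size w) w'); congr (_ ++ _).
  by rewrite -(takel_cat v' le) -eq take_size_cat.
have [le|/ltnW le] := leqP (size w2) (size w1).
  have tr2' : tracked g' (ext (x.1, [::]) w1) K.
    by rewrite (wP w2 v2 w1 v1) -?eq1 // -extA; apply: tracked_ext.
  exists (ext (x.1, [::]) w1), (prepend v1 (shift L x.2)); split.
  - exact: xE.
  - exact: tracked_level tr1.
  - right; apply: (tracked_forever_back gK ge1); apply: bound2 => //.
    apply: tracked_leq (leq_maxr K1 K2) _.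
    exact (tracked_back gK jK1 tr1 tr2' ge1).
have tr1' : tracked g (ext (x.1, [::]) w2) K.
  by rewrite (wP w1 v1 w2 v2) -?eq1 // -extA; apply: tracked_ext.
exists (ext (x.1, [::]) w2), (prepend v2 (shift L x.2)); split.
- exact: xE.
- exact: tracked_level tr2.
- left; apply: (tracked_forever_back g'K ge2); apply: bound1 => //.
  apply: tracked_leq (leq_maxl K1 K2) _.
  exact (tracked_back g'K jK2 tr2 tr1' ge2).
Qed.

Definition periodic_code g m (t : 'I_r * D.-tuple 'I_n) :=
  exists v, acts (iter m g) (code_of t) (ext (code_of t) v).

Lemma periodic_codeM g m k t : periodic_code g m t -> periodic_code g (m * k) t.
Proof.
case=> v gv; elim: k => [|k [u gu]].
  by exists [::]; rewrite muln0 ext_nil.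
by exists (u ++ v); rewrite mulnS -extA; apply: acts_iterD gv (acts_ext v gu).
Qed.

(** A common multiple of the finitely many periods. *)
Lemma common_period g : exists2 N, 0 < N & forall t,
  (exists2 m, 0 < m & periodic_code g m t) -> periodic_code g N t.
Proof.
have /choice [k kP] : forall t, exists k, 0 < k /\
    ((exists2 m, 0 < m & periodic_code g m t) -> periodic_code g k t).
  move=> t; have [[m m0 gm]|no] := pselect (exists2 m, 0 < m & periodic_code g m t).
    by exists m.
  by exists 1.
exists (\prod_t k t) => [|t per]; first by rewrite prodn_gt0 // => t; case: (kP t).
rewrite (bigD1 t) //=; apply: periodic_codeM; exact: (kP t).2.
Qed.

(** The exponent is even because [attracted_commute] has to return to [x] along
    powers of [f \o f].  When [v] is empty, [f] is the identity on the cylinder. *)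
Definition attracted f x := exists J e v s,
  iter (2 * J) f x = cyl e s /\ acts f e (ext e v).

(** Pushing the cylinder of [tracked_forever_cycle] further along its orbit
    preserves its property, so the time at which the orbit of [c] enters it can
    be made a multiple of [2 * N]. *)
Lemma tracked_attracted g N c s : 0 < N ->
  (forall t, (exists2 m, 0 < m & periodic_code g m t) -> periodic_code g N t) ->
  acts_deep g -> D <= level c -> tracked_forever g c ->
  attracted (iter N g) (cyl c s).
Proof.
move=> N0 NP gD Dc tr.
have [J [m [_ [w [v [m0 /code_ofP [t ->] tre gJ gm]]]]]] := tracked_forever_cycle gD Dc tr.
have [v' gN] : periodic_code g N t by apply: NP; exists m => //; exists v.
(* J + i = 2 * N * J *)
pose i := (2 * N).-1 * J.
have [e De gi] := tre i i (leqnn i).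
exists J, e, v', (prepend w s); split.
  rewrite -iterM -gi -cyl_ext -gJ -iterD; congr (iter _ _ _); rewrite /i.
  by case: (N) N0 => // k _; lia.
by move=> z; rewrite -gi -iterD addnC iterD gN !cyl_ext gi.
Qed.

Lemma acts_deep_attracted g g' : cancel g g' -> cancel g' g ->
  acts_deep g -> acts_deep g' -> exists2 N, 0 < N &
  forall x, attracted (iter N g) x \/ attracted (iter N g') x.
Proof.
move=> gK g'K gD g'D; have [N1 N10 P1] := common_period g.
have [N2 N20 P2] := common_period g'.
exists (N1 * N2) => [|x]; first by rewrite muln_gt0 N10.
have [c [s [-> Dc [tr|tr]]]] := tracked_forever_dichotomy x gK g'K gD g'D.
  left; apply: tracked_attracted; rewrite ?muln_gt0 ?N10 // => t /P1.
  exact: periodic_codeM.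
right; apply: tracked_attracted; rewrite ?muln_gt0 ?N10 // => t /P2.
by rewrite mulnC; apply: periodic_codeM.
Qed.

End Tracking.

(** * Commuting with the square *)

(** The germ of [f] at the fixed point [cyl e s].  The prefixed word is given by
    its length [p] alone: it must be an initial segment of [s], because the
    point is fixed.  The condition on [s] is that [s] is periodic of period [p];
    for [p = 0] it says nothing, and [f] is the identity on the cylinder. *)
Definition fixes f e s p := acts f e (ext e (mkseq s p)) /\ shift p s = s.

Lemma shiftD j k s : shift j (shift k s) = shift (k + j) s.
Proof. by apply/funext => i; rewrite /shift addnA. Qed.

Lemma fixes_cyl f e s p : fixes f e s p -> f (cyl e s) = cyl e s.
Proof. by case=> fe sp; rewrite fe cyl_ext -{2}sp prepend_shift. Qed.

Lemma fixes_shift f e s p k : fixes f e s p ->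
  fixes f (ext e (mkseq s k)) (shift k s) p.
Proof.
case=> fe sp; split; last by rewrite shiftD addnC -shiftD sp.
by rewrite extA -mkseqD addnC mkseqD sp -extA; apply: acts_ext.
Qed.

Lemma fixes_double f e s p : fixes f e s p -> fixes (f \o f) e s (p + p).
Proof.
case=> fe sp; split; last by rewrite -shiftD !sp.
by rewrite mkseqD sp -extA; apply: acts_comp fe (acts_ext _ fe).
Qed.

(** Both [s] and [prepend v s] arise from each other by prefixing [v], so they agree
    on longer and longer initial segments. *)
Lemma prepend_fixed v s : s = prepend v (prepend v s) -> s = prepend v s.
Proof.
move=> sE; apply/funext; elim/ltn_ind => i IH.
have [iv|vi] := ltnP i (size v).
  by rewrite {1}sE /prepend !(set_nth_default (s 0)).
rewrite {1}sE /prepend nth_default // [RHS]nth_default //.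
case: (posnP (size v)) => [/size0nil -> |v0]; first by rewrite !nth_nil !subn0.
rewrite -/(prepend v s _) -IH //; lia.
Qed.

Lemma fixes_prepend f e s v :
  acts f e (ext e v) -> s = prepend v s -> fixes f e s (size v).
Proof.
move=> fe sv; have [vE sE] : v = mkseq s (size v) /\ s = shift (size v) s.
  apply: prepend_inj; first by rewrite size_mkseq.
  by rewrite prepend_shift.
by rewrite /fixes -vE.
Qed.

Lemma fixes_inj f e s p q : fixes f e s p -> fixes f e s q -> p = q.
Proof.
move=> [fp _] [fq _]; have /(congr1 level) := acts_inj fp fq.
by rewrite !level_ext !size_mkseq => /addnI.
Qed.

Lemma fixes_cancel f f' e s p q :
  cancel f f' -> fixes f e s p -> fixes f' e s q -> p = 0 /\ q = 0.
Proof.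
move=> fK [fe sp] [f'e sq].
have idc : acts (f' \o f) e e by move=> z /=.
have /(congr1 level) := acts_inj (acts_comp fe (acts_ext (mkseq s p) f'e)) idc.
by rewrite !level_ext !size_mkseq; lia.
Qed.

Section Square.
Variables f f' : point -> point.
Hypotheses (fK : cancel f f') (f'K : cancel f' f).
Hypothesis f_attr : forall x, attracted f x \/ attracted f' x.

(** A fixed point of [k \o k] cannot move towards the attracting point, so it lies
    in the cylinder that [k] maps into itself. *)
Lemma attracted_fixed k x : (k \o k) x = x -> attracted k x ->
  exists e s p, x = cyl e s /\ fixes k e s p.
Proof.
move=> kx [J [e [v [s []]]]]; rewrite mulnC iterM (iter_fix _ kx) => xE ke.
exists e, s, (size v); split=> //; apply: fixes_prepend => //.
apply: prepend_fixed; move: kx; rewrite xE /= !ke !cyl_ext ke cyl_ext.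
by move/(cyl_inj (erefl _)) => [].
Qed.

(** By [f_attr] and [attracted_fixed] the point [cyl e s] is fixed by [f], with a
    germ that prefixes some word in a small cylinder.  As a germ at a fixed
    point is determined by its length, and squaring doubles the length, that
    length is [p].  If it is the inverse of [f] that prefixes a word, then
    [f \o f] prefixes a word and its inverse does too, so both are empty. *)
Lemma fixes_half e s p : fixes (f \o f) e s (p + p) ->
  exists k, fixes f (ext e (mkseq s k)) (shift k s) p.
Proof.
move=> fe; pose b := cyl e s; have fb : (f \o f) b = b := fixes_cyl fe.
have f'b : (f' \o f') b = b by rewrite -{1}fb /= !fK.
have meet e3 s3 : b = cyl e3 s3 ->
    ext e (mkseq s (level e3)) = ext e3 (mkseq s3 (level e)) /\
    shift (level e3) s = shift (level e) s3.
  move=> bE; apply: cyl_inj; first by rewrite !level_ext !size_mkseq addnC.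
  by rewrite !cyl_ext !prepend_shift.
have [/(attracted_fixed fb)|/(attracted_fixed f'b)] := f_attr b.
  move=> [e3 [s3 [q [/meet [eE sE]]]]] /(fixes_shift (level e)).
  rewrite -eE -sE => fe3; exists (level e3).
  have := fixes_inj (fixes_double fe3) (fixes_shift (level e3) fe).
  by move=> eq; have <- : q = p by lia.
move=> [e3 [s3 [q [/meet [eE sE]]]]] /(fixes_shift (level e)).
rewrite -eE -sE => f'e3; exists (level e3).
have ffK : cancel (f \o f) (f' \o f') by apply: can_comp.
have [p0 q0] := fixes_cancel ffK (fixes_shift (level e3) fe) (fixes_double f'e3).
have -> : p = 0 by lia.
have q00 : q = 0 by lia.
case: f'e3 => + _; rewrite q00 ext_nil => f'e3.
split; last by [].
by rewrite ext_nil; apply: acts_inv f'K f'e3.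
Qed.

Variables (h : point -> point) (Dh : nat).
Hypothesis h_deep : acts_deep Dh h.
Hypothesis hff : forall x, h (f (f x)) = f (f (h x)).

(** [h] commutes with the even powers of [f], so commuting with [f] can be
    transported back along the orbit. *)
Lemma commute_iter x k : h (f (iter (2 * k) f x)) = f (h (iter (2 * k) f x)) ->
   h (f x) = f (h x).
Proof.
have iter_inj m : injective (iter m f).
  by elim: m => // m IH y1 y2 /(can_inj fK) /IH.
have hiter y : h (iter (2 * k) f y) = iter (2 * k) f (h y).
  elim: k => // k IH.
  have iterSS x1 : iter (2 * k.+1) f x1 = f (f (iter (2 * k) f x1)) by rewrite mulnS.
  by rewrite !iterSS hff IH.
rewrite -iterS iterSr !hiter -iterS iterSr; apply: iter_inj.
Qed.

(** Near the attracting point [h] replaces a prefix, so it transports the germ of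
    [f \o f] there to the germ of [f \o f] at the image of that point; by
    [fixes_half] the germ of [f] is transported as well.  Hence [h] and [f]
    commute near the attracting point, which the orbit of [x] approaches. *)
Lemma attracted_commute x : attracted f x -> h (f x) = f (h x).
Proof.
move=> [J [e [v [z [xE fe]]]]]; apply: (@commute_iter x J); rewrite xE {x xE J}.
have [s [fs reach]] : exists s, fixes f e s (size v) /\
    forall l, exists k z', iter (2 * k) f (cyl e z) = cyl (ext e (mkseq s l)) z'.
  case: (posnP (size v)) => [v0|v0].
    (* [f] is the identity on the cylinder, and any point of it will do. *)
    exists z; split; first by apply: fixes_prepend; rewrite // (size0nil v0) prepend_nil.
    by move=> l; exists 0, (shift l z); rewrite cyl_ext prepend_shift.
  (* the attracting point is v v v ... *)
  pose s i := nth (z 0) v (i %% size v).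
  have sv : s = prepend v s.
    apply/funext => i; rewrite /prepend; have [iv|vi] := ltnP i (size v).
      by rewrite /s modn_small //; apply: set_nth_default.
    by rewrite nth_default // /s -{1}(subnK vi) modnDr.
  have fs := fixes_prepend fe sv; exists s; split=> // l.
  exists l; have [fe1 s1] := fs.
  have : acts (iter (2 * l) f) e (ext e (mkseq s (2 * l * size v))).
    elim: (2 * l) => [|m IH]; first by rewrite ext_nil.
    by rewrite mulSn mkseqD s1 -extA; apply: acts_iterS IH (acts_ext _ fe1).
  move=> ->; exists (prepend (mkseq (shift l s) (2 * l * size v - l)) z).
  rewrite -cyl_ext extA -mkseqD subnKC //; nia.
pose e1 := ext e (mkseq s Dh); pose s1 := shift Dh s.
have fs1 : fixes f e1 s1 (size v) := fixes_shift Dh fs.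
have [e2 he1] : exists e2, acts h e1 e2.
  by apply: h_deep; rewrite level_ext size_mkseq leq_addl.
have ffs2 : fixes (f \o f) e2 s1 (size v + size v).
  have [ff1 ss1] := fixes_double fs1; split=> // w.
  by rewrite -he1 /= -hff [f (f _)]ff1 (acts_ext _ he1).
have [k [fe3 _]] := fixes_half ffs2.
have [fe4 _] := fixes_shift k fs1.
have [J [z' yE]] := reach (Dh + k).
apply: (@commute_iter _ J); rewrite yE mkseqD -extA -/e1 -/s1 fe4.
by rewrite [in RHS](acts_ext _ he1) fe3 extA (acts_ext _ he1) -extA.
Qed.

End Square.

End Cylinders.

(** * Groups of prefix replacements *)

Section PrefixLocal.
Variables n r : nat.
Local Notation point := (cantor_copies n r).
Local Notation selfbij := (selfbij point).

(** Asking the inverse to replace prefixes too makes closure under the group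
    operations immediate. *)
Definition prefix_local : set selfbij :=
  [set f : selfbij | exists D, acts_deep D f /\ acts_deep D (sbinv f)].

Lemma cyl_prefix (c e : interval_code n r) s z : cyl c s = cyl e z -> level c <= level e ->
  exists w, e = ext c w.
Proof.
move=> eq le; exists (drop (level c) e.2).
rewrite -[e in LHS](_ : ext (e.1, take (level c) e.2) (drop (level c) e.2) = e); last first.
  by rewrite /ext /= cat_take_drop; case: (e).
have sz : level c = level (e.1, take (level c) e.2) by rewrite /level /= size_takel.
have E : cyl c s = cyl (e.1, take (level c) e.2) (prepend (drop (level c) e.2) z).
  rewrite -cyl_ext eq; congr cyl.
  by rewrite /ext /= cat_take_drop; case: (e).
by have [{1}<- _] := cyl_inj sz E.
Qed.

Lemma acts_deep_leq D D' (f : point -> point) : D <= D' -> acts_deep D f -> acts_deep D' f.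
Proof. by move=> le fD c /(leq_trans le)/fD. Qed.

Lemma acts_deep_comp D D' (f g : point -> point) :
  acts_deep D f -> acts_deep D' g -> acts_deep (D' + D) (f \o g).
Proof.
move=> fD gD c le; have [e1 ge1] : exists e, acts g (c.1, take D' c.2) e.
  by apply: gD; rewrite /level /= size_takel // (leq_trans _ le) ?leq_addr.
have cE : c = ext (c.1, take D' c.2) (drop D' c.2).
  by rewrite /ext /= cat_take_drop; case: (c).
have [e fe] : exists e, acts f (ext e1 (drop D' c.2)) e.
  by apply: fD; rewrite level_ext size_drop -/(level c); lia.
by exists e; rewrite cE; apply: acts_comp (acts_ext _ ge1) fe.
Qed.

Lemma prefix_local_group : group_closed [in prefix_local].
Proof.
split=> [|f g].
  by rewrite inE; exists 0; split=> c _; exists c.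
rewrite !inE => -[D [fD f'D]] [D' [gD g'D]].
exists (D + D'); split; last exact: (acts_deep_comp gD f'D).
by rewrite addnC; apply: (acts_deep_comp fD g'D).
Qed.

Hypothesis n_gt1 : 1 < n.

Lemma interval_pattern_cover P (x : point) : interval_pattern P ->
  exists2 c, c \in P & exists z, x = cyl c z.
Proof.
elim=> [|s1 i w s2 _ [c]].
  exists (x.1, [::]); first by apply: map_f; rewrite mem_enum.
  by exists x.2; rewrite /cyl prepend_nil; case: (x).
rewrite mem_cat inE orbCA => /predU1P[->|cs] [z xE]; last first.
  by exists c; [rewrite !mem_cat orbCA cs orbT|exists z].
exists (i, rcons w (z 0)).
  by rewrite !mem_cat; apply/orP; right; apply/orP; left; apply: map_f; rewrite mem_enum.
exists (shift 1 z); rewrite xE -cats1 /cyl /= prepend_cat.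
by rewrite -{1}(prepend_shift z 1).
Qed.

(** The intervals of a pattern cover the space, so a cylinder that is deeper than
    all of them lies in one of them. *)
Lemma exchange_deep m (P Q : m.-tuple (interval_code n r)) sigma (f : selfbij) :
  interval_pattern P -> is_exchange P Q sigma f ->
  acts_deep (\max_(i < m) level (tnth P i)) f.
Proof.
move=> pP fPQ e De.
have a : 'I_n := Ordinal n_gt1.
have [c /tnthP [i ->] [z eq]] := interval_pattern_cover (cyl e (fun=> a)) pP.
have le : level (tnth P i) <= level e.
  by apply: leq_trans De; apply: (leq_bigmax i).
have [w ->] := cyl_prefix (esym eq) le.
exists (ext (tnth Q (sigma i)) w); apply: acts_ext => s; exact: fPQ.
Qed.

Lemma HigmanV_prefix_local : (HigmanV n r `<=` prefix_local)%classic.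
Proof.
move=> f [m [P [Q [sigma [pP pQ fPQ]]]]].
have f'QP : is_exchange Q P (sigma^-1)%g (sb_inv f).
  move=> i z; rewrite -[i in LHS](permKV sigma) /=.
  by rewrite -fPQ; apply: sbfunK.
exists (maxn (\max_(i < m) level (tnth P i)) (\max_(i < m) level (tnth Q i))).
split.
  exact: acts_deep_leq (leq_maxl _ _) (exchange_deep pP fPQ).
exact: acts_deep_leq (leq_maxr _ _) (exchange_deep pQ f'QP).
Qed.

(** [attracted_commute] needs the point to be attracted by [f = g ^ N].  Points
    attracted by the inverse of [f] are treated by exchanging the two maps. *)
Lemma prefix_local_commute (g : selfbij) : prefix_local g -> exists2 N, 0 < N &
  forall h, prefix_local h -> (h * g ^+ (2 * N) = g ^+ (2 * N) * h)%g ->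
  (h * g ^+ N = g ^+ N * h)%g.
Proof.
case=> D [gD g'D].
have [N N0 attr] := acts_deep_attracted n_gt1 (@sbfunK _ g) (@sbinvK _ g) gD g'D.
exists N => // h [Dh [hD _]] eq.
pose f := (g ^+ N)%g; pose f' := sbinv f.
have fE x : f x = iter N g x := sb_expE g N x.
have f'E x : f' x = iter N (sbinv g) x.
  rewrite -{1}[x](_ : f (iter N (sbinv g) x) = x) /f'; first exact: sbfunK.
  by rewrite fE; elim: (N) => // k IH; rewrite iterSr [iter k.+1 (sbinv g) x]iterS sbinvK IH.
have {}attr x : attracted f x \/ attracted f' x.
  by move: (attr x); rewrite -(funext fE) -(funext f'E).
have hff x : h (f (f x)) = f (f (h x)).
  move/(congr1 (fun k : selfbij => k x)): eq.
  rewrite !sb_mulE !sb_expE.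
  have E y : iter (2 * N) g y = f (f y) by rewrite iterM /= -!fE.
  by rewrite !E !fE.
apply: selfbijP => x; change (h (f x) = f (h x)).
have fK : cancel f f' := @sbfunK _ f.
have f'K : cancel f' f := @sbinvK _ f.
have [fx|f'x] := attr x; first exact: (attracted_commute n_gt1 fK f'K attr hD hff).
have f'x' : attracted f' (f x).
  have [J [e [v [s [eqs f'e]]]]] := f'x; exists J.+1, e, v, (prepend v s).
  split=> //; have -> : 2 * J.+1 = (2 * J).+2 by lia.
  by rewrite iterSr fK iterS eqs f'e cyl_ext.
have attr' y : attracted f' y \/ attracted f y by case: (attr y); [right|left].
have hff' y : h (f' (f' y)) = f' (f' (h y)).
  by apply: (can_inj fK); apply: (can_inj fK); rewrite -hff !f'K.
have := attracted_commute n_gt1 f'K fK attr' hD hff' f'x'.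
by rewrite fK => ->; rewrite f'K.
Qed.

End PrefixLocal.

(** * The Cantor set as a set of binary sequences *)

Section CantorSet.
Import Order.TTheory GRing.Theory Num.Theory.
Local Open Scope classical_set_scope.
Local Open Scope ring_scope.
Variable R : realType.
Local Notation cantor := (@cantor R).

Definition push (b : bool) (x : R) : R := ((if b then 2 else 0) + x) / 3.

Lemma cantor_levelS k (y : R) :
  cantor_level k.+1 y <-> exists b x, cantor_level k x /\ y = push b x.
Proof.
rewrite /= /push; split=> [[[x Lx <-]|[x Lx <-]]|[[] [x [Lx ->]]]].
- by exists false, x; rewrite add0r.
- by exists true, x.
- by right; exists x.
- by left; exists x; rewrite // add0r.
Qed.

Lemma cantor_level01 k (x : R) : cantor_level k x -> 0 <= x <= 1.
Proof.
elim: k x => [x /=|k IH x]; first by rewrite in_itv.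
by move=> /cantor_levelS [b [y [/IH /andP [y0 y1] ->]]]; rewrite /push; case: b; lra.
Qed.

Lemma cantor01 (x : R) : cantor x -> 0 <= x <= 1.
Proof. by move=> /(_ 0%N I) /cantor_level01. Qed.

Lemma cantor_push b (x : R) : cantor x -> cantor (push b x).
Proof.
move=> Cx [|k] _.
  have /andP [x0 x1] := cantor01 Cx.
  by rewrite /= in_itv /= /push; case: b; lra.
by apply/cantor_levelS; exists b, x; split=> //; apply: Cx.
Qed.

Lemma push_inj b b' (x x' : R) : 0 <= x <= 1 -> 0 <= x' <= 1 ->
  push b x = push b' x' -> b = b' /\ x = x'.
Proof.
by rewrite /push; case: b b' => [] [] /andP [x0 x1] /andP [x'0 x'1] E; split=> //; lra.
Qed.

(** The first digit is the same at all levels since the two thirds are disjoint. *)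
Lemma cantor_pop (y : R) : cantor y -> exists b x, cantor x /\ y = push b x.
Proof.
move=> Cy; have /cantor_levelS [b [x [/cantor_level01 x01 yE]]] := Cy 1%N I.
exists b, x; split=> // k _.
have /cantor_levelS [b' [x' [Lx' yE']]] := Cy k.+1 I.
have [_ ->] // := push_inj x01 (cantor_level01 Lx') (etrans (esym yE) yE').
Qed.

Lemma cantor0 : cantor 0.
Proof.
move=> k _; elim: k => [|k IH]; first by rewrite /= in_itv /= lexx ler01.
by apply/cantor_levelS; exists false, 0; split=> //; rewrite /push; lra.
Qed.

Lemma cantor1 : cantor 1.
Proof.
move=> k _; elim: k => [|k IH]; first by rewrite /= in_itv /= lexx ler01.
by apply/cantor_levelS; exists true, 1; split=> //; rewrite /push; lra.
Qed.

Local Notation K := (set_type cantor).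

Definition cpoint (x : R) (Cx : cantor x) : K := exist _ x (mem_set Cx).

Lemma cantor_val (x : K) : cantor (val x).
Proof. exact/set_mem/(valP x). Qed.

Definition cpush b (x : K) : K := cpoint (cantor_push b (cantor_val x)).

Lemma cpush_surj (y : K) : exists p : bool * K, cpush p.1 p.2 = y.
Proof.
have [b [x [Cx yE]]] := cantor_pop (cantor_val y).
by exists (b, cpoint Cx); apply: val_inj; rewrite /= -yE.
Qed.

Definition chead y := (sval (cid (cpush_surj y))).1.
Definition ctail y := (sval (cid (cpush_surj y))).2.

Lemma cpushK y : cpush (chead y) (ctail y) = y.
Proof. by rewrite /chead /ctail; case: (cid _). Qed.

Lemma cpush_inj b b' x x' : cpush b x = cpush b' x' -> b = b' /\ x = x'.
Proof. by move=> /(congr1 val) /push_inj [||-> /val_inj ->] //; apply/cantor01/cantor_val. Qed.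

Lemma chead_cpush b x : chead (cpush b x) = b.
Proof. by case: (cpush_inj (cpushK (cpush b x))). Qed.

Lemma ctail_cpush b x : ctail (cpush b x) = x.
Proof. by case: (cpush_inj (cpushK (cpush b x))). Qed.

Definition wpush (u : seq bool) (x : K) : K := foldr cpush x u.

Fixpoint digits k x := if k is k'.+1 then chead x :: digits k' (ctail x) else [::].

Lemma digitsK k x : wpush (digits k x) (iter k ctail x) = x.
Proof. by elim: k x => // k IH x; rewrite iterSr /= IH cpushK. Qed.

Lemma digits_wpush u x : digits (size u) (wpush u x) = u.
Proof. by elim: u => //= b u IH; rewrite chead_cpush ctail_cpush IH. Qed.

Lemma tail_wpush u x : iter (size u) ctail (wpush u x) = x.
Proof. by elim: u => [//|b u IH]; rewrite [size _]/= iterSr /= ctail_cpush. Qed.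

Lemma wpush_cat u v x : wpush (u ++ v) x = wpush u (wpush v x).
Proof. exact: foldr_cat. Qed.

Lemma digitsS k x : digits k.+1 x = rcons (digits k x) (chead (iter k ctail x)).
Proof. by elim: k x => // k IH x; rewrite [LHS]/= -/(digits k.+1 _) IH [in RHS]iterSr. Qed.

Lemma wpush_inj_size u v x y : size u = size v -> wpush u x = wpush v y -> u = v /\ x = y.
Proof.
by move=> suv eq; rewrite -(digits_wpush u x) -{2}(tail_wpush u x) eq suv digits_wpush tail_wpush.
Qed.

(** If [v] were longer than [u], its extra letter would be the first digit of every
    point of the Cantor set. *)
Lemma wpush_inj u v : (forall x, wpush u x = wpush v x) -> u = v.
Proof.
wlog: u v / (size u <= size v)%N => [W eq|suv eq].
  have [le|/ltnW le] := leqP (size u) (size v); first exact: W.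
  by apply/esym/W => // x; rewrite eq.
have E x : u = take (size u) v /\ x = wpush (drop (size u) v) x.
  apply: wpush_inj_size; first by rewrite size_takel.
  by rewrite eq -wpush_cat cat_take_drop.
have [uE _] := E (cpoint cantor0).
case vE : (drop (size u) v) => [|b w].
  by rewrite -(cat_take_drop (size u) v) vE cats0.
have [_] := E (cpush (~~ b) (cpoint cantor0)); rewrite vE /=.
by case/cpush_inj; case: (b).
Qed.

End CantorSet.

(** * Bijections of the Cantor square that replace prefixes *)

Section CantorSquare.
Import Order.TTheory GRing.Theory Num.Theory.
Local Open Scope classical_set_scope.
Variable R : realType.
Local Notation K := (set_type (@cantor R)).
Local Notation X := (set_type (@cantor_sq R)).
Local Notation code := (seq bool * seq bool)%type.
Implicit Types (c d e : code) (p q : K * K).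

Definition of_pair p : X :=
  exist _ (val p.1, val p.2) (mem_set (conj (cantor_val p.1) (cantor_val p.2))).

Definition to_pair (x : X) : K * K :=
  (cpoint (proj1 (set_mem (valP x))), cpoint (proj2 (set_mem (valP x)))).

Lemma of_pairK : cancel of_pair to_pair.
Proof. by case=> a b; congr (_, _); apply: val_inj. Qed.

Lemma to_pairK : cancel to_pair of_pair.
Proof. by move=> x; apply: val_inj; rewrite /=; case: (val x). Qed.

Definition cext c d : code := (c.1 ++ d.1, c.2 ++ d.2).
Definition box c p : K * K := (wpush c.1 p.1, wpush c.2 p.2).
Definition covers p c :=
  (digits (size c.1) p.1 == c.1) && (digits (size c.2) p.2 == c.2).
Definition sizes c := (size c.1, size c.2).

Lemma cext0 c : cext c ([::], [::]) = c.
Proof. by case: c => a b; rewrite /cext !cats0. Qed.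

Lemma sizes_cext c d : sizes (cext c d) = (size c.1 + size d.1, size c.2 + size d.2).
Proof. by rewrite /sizes /= !size_cat. Qed.

Lemma box_cext c d p : box (cext c d) p = box c (box d p).
Proof. by rewrite /box /= !wpush_cat. Qed.

Lemma box_inj_sizes c d p q : sizes c = sizes d -> box c p = box d q -> c = d.
Proof.
case: c d => [a b] [a' b'] [sa sb] [] /(wpush_inj_size sa) [/= -> _].
by move/(wpush_inj_size sb) => [/= -> _].
Qed.

Lemma box_inj c d : box c =1 box d -> c = d.
Proof.
case: c d => [a b] [a' b'] E.
congr pair; apply: wpush_inj => x.
  by have [] := E (x, x).
by have [] := E (x, x).
Qed.

Lemma coversP p c : reflect (exists q, p = box c q) (covers p c).
Proof.
apply: (iffP andP) => [[/eqP c1 /eqP c2]|[q ->]]; last first.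
  by rewrite !digits_wpush !eqxx.
exists (iter (size c.1) (@ctail R) p.1, iter (size c.2) (@ctail R) p.2).
rewrite [LHS]surjective_pairing; congr (_, _) => /=.
  by rewrite -[X in wpush X]c1 digitsK.
by rewrite -[X in wpush X]c2 digitsK.
Qed.

Definition moves (f : X -> X) c d := forall p, f (of_pair (box c p)) = of_pair (box d p).

Lemma moves_cext f c d e : moves f c d -> moves f (cext c e) (cext d e).
Proof. by move=> fcd p; rewrite !box_cext fcd. Qed.

Lemma moves_inj f c d e : moves f c d -> moves f c e -> d = e.
Proof.
by move=> fd fe; apply: box_inj => p; apply: (can_inj of_pairK); rewrite -fd -fe.
Qed.

Definition box_local : set (selfbij X) :=
  [set f | exists D, forall c, D <= size c.1 -> D <= size c.2 -> exists d, moves f c d].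

Lemma box_localM f g : box_local f -> box_local g -> box_local (f * g)%g.
Proof.
move=> [D fD] [D' gD]; exists (D' + D) => c c1 c2.
have [d gd] : exists d, moves g (take D' c.1, take D' c.2) d.
  by apply: gD; rewrite size_takel //=; lia.
pose w : code := (drop D' c.1, drop D' c.2).
have [e fe] : exists e, moves f (cext d w) e.
  by apply: fD; rewrite /= size_cat size_drop; lia.
have cE : c = cext (take D' c.1, take D' c.2) w.
  by rewrite /cext /= !cat_take_drop; case: (c).
by exists e => p; rewrite cE /= (moves_cext w gd) fe.
Qed.

Lemma box_local1 : box_local 1%g.
Proof. by exists 0 => c _ _; exists c. Qed.

Lemma box_localX f k : box_local f -> box_local (f ^+ k)%g.
Proof.
move=> fl; elim: k => [|k IH]; first exact: box_local1.
by rewrite expgS; apply: box_localM.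
Qed.

(** * Rectangles of codes *)

Section Geometry.
Local Open Scope ring_scope.

Definition halve (b : bool) (x : R) : R := ((if b then 1 else 0) + x) / 2.

Definition dyadic u x := foldr halve x u.
Definition triadic u x := foldr (@push R) x u.

Definition code_rect c :=
  Rect (dyadic c.1 0) (dyadic c.1 1) (dyadic c.2 0) (dyadic c.2 1).

Definition code_part c : set (R * R) :=
  [set (triadic c.1 p.1, triadic c.2 p.2) | p in @cantor_sq R].

Lemma dyadicE u x : dyadic u x = dyadic u 0 + 2^-1 ^+ size u * x.
Proof.
elim: u => [|b u IH] /=; first by rewrite add0r mul1r.
rewrite IH /halve exprS; lra.
Qed.

Lemma triadicE u x : triadic u x = triadic u 0 + 3^-1 ^+ size u * x.
Proof.
elim: u => [|b u IH] /=; first by rewrite add0r mul1r.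
rewrite IH /push exprS; lra.
Qed.

Lemma dyadic_bounds u x : 0 < x < 1 -> 0 < dyadic u x < 1.
Proof.
move=> x01; elim: u => //= b u; rewrite /halve; case: b; lra.
Qed.

(** The value at 0 and the length of the interval determine the word: the length
    gives the number of digits, and the midpoint decides each of them. *)
Lemma dyadic_inj u v : dyadic u 0 = dyadic v 0 -> dyadic u 1 = dyadic v 1 -> u = v.
Proof.
move=> E0 E1; have E x : dyadic u x = dyadic v x.
  rewrite dyadicE [RHS]dyadicE E0; congr (_ + _ * _).
  move: E1; rewrite dyadicE [RHS]dyadicE E0; lra.
have size_eq : size u = size v.
  have := E 1; rewrite dyadicE [RHS]dyadicE E0 !mulr1 => /addrI /eqP.
  rewrite !exprVn (inj_eq invr_inj) => /eqP.
  by apply: (ieexprIn (x := 2 : R)); rewrite ?ltr0n // ?pnatr_eq1.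
elim: u v size_eq E {E0 E1} => [|b u IH] [|b' v] //= [suv] E.
have half01 : 0 < (2^-1 : R) < 1 by lra.
have bE : b = b'.
  have := E (2^-1); have := dyadic_bounds u half01; have := dyadic_bounds v half01.
  by rewrite /halve; case: b b' {E} => [] [] //; lra.
by rewrite bE (IH v) // => x; have := E x; rewrite /halve bE; lra.
Qed.

Lemma code_rect_inj : injective code_rect.
Proof.
by case=> [a b] [a' b'] [] /= E1 E2 E3 E4; rewrite (dyadic_inj E1 E2) (dyadic_inj E3 E4).
Qed.

Lemma dyadic_rcons u b x : dyadic (rcons u b) x = dyadic u (halve b x).
Proof. exact: foldr_rcons. Qed.

Lemma triadic_rcons u b x : triadic (rcons u b) x = triadic u (push b x).
Proof. exact: foldr_rcons. Qed.

Lemma code_rect_left u v : code_rect (rcons u false, v) = left_half (code_rect (u, v)).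
Proof.
rewrite /left_half /xpart /code_rect /= !dyadic_rcons; congr Rect.
  by rewrite /halve dyadicE; lra.
by rewrite dyadicE [dyadic u 1]dyadicE /halve; lra.
Qed.

Lemma code_rect_right u v : code_rect (rcons u true, v) = right_half (code_rect (u, v)).
Proof.
rewrite /right_half /xpart /code_rect /= !dyadic_rcons; congr Rect.
  by rewrite dyadicE [dyadic u 1]dyadicE /halve; lra.
by rewrite dyadicE [dyadic u 1]dyadicE /halve; lra.
Qed.

Lemma code_rect_bottom u v : code_rect (u, rcons v false) = bottom_half (code_rect (u, v)).
Proof.
rewrite /bottom_half /ypart /code_rect /= !dyadic_rcons; congr Rect.
  by rewrite /halve dyadicE; lra.
by rewrite dyadicE [dyadic v 1]dyadicE /halve; lra.
Qed.

Lemma code_rect_top u v : code_rect (u, rcons v true) = top_half (code_rect (u, v)).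
Proof.
rewrite /top_half /ypart /code_rect /= !dyadic_rcons; congr Rect.
  by rewrite dyadicE [dyadic v 1]dyadicE /halve; lra.
by rewrite dyadicE [dyadic v 1]dyadicE /halve; lra.
Qed.

Lemma triadic_le u x y : (triadic u x <= triadic u y) = (x <= y).
Proof.
rewrite triadicE [triadic u y]triadicE lerD2l ler_pM2l //.
by rewrite exprn_gt0 // invr_gt0 ltr0n.
Qed.

Lemma inf_min (A : set R) m : A m -> (forall x, A x -> m <= x) -> inf A = m.
Proof.
move=> Am lb; apply/eqP; rewrite eq_le; apply/andP; split.
  by apply: ge_inf => //; exists m.
by apply: lb_le_inf => //; exists m.
Qed.

Lemma sup_max (A : set R) m : A m -> (forall x, A x -> x <= m) -> sup A = m.
Proof.
move=> Am ub; apply/eqP; rewrite eq_le; apply/andP; split.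
  by apply: ge_sup => //; exists m.
by apply: ub_le_sup => //; exists m.
Qed.

Lemma hull_code_part c : hull (code_part c) =
  Rect (triadic c.1 0) (triadic c.1 1) (triadic c.2 0) (triadic c.2 1).
Proof.
have C0 := cantor0 R; have C1 := cantor1 R.
have in_part x y : cantor x -> cantor y -> code_part c (triadic c.1 x, triadic c.2 y).
  by move=> Cx Cy; exists (x, y).
congr Rect.
- apply: inf_min => [|_ [_ [[x y] [/= /cantor01/andP [x0 _] _] <-] <-]].
    by exists (triadic c.1 0, triadic c.2 0); first exact: in_part.
  by rewrite triadic_le.
- apply: sup_max => [|_ [_ [[x y] [/= /cantor01/andP [_ x1] _] <-] <-]].
    by exists (triadic c.1 1, triadic c.2 0); first exact: in_part.
  by rewrite triadic_le.
- apply: inf_min => [|_ [_ [[x y] [/= _ /cantor01/andP [y0 _]] <-] <-]].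
    by exists (triadic c.1 0, triadic c.2 0); first exact: in_part.
  by rewrite triadic_le.
- apply: sup_max => [|_ [_ [[x y] [/= _ /cantor01/andP [_ y1]] <-] <-]].
    by exists (triadic c.1 1, triadic c.2 1); first exact: in_part.
  by rewrite triadic_le.
Qed.

(** [P] is the strip that holds the outer third to be cut off; it contains the half
    [A] of the self-similar set [S] and misses the half [B]. *)
Lemma part_cut (A B S P : set (R * R)) : S = A `|` B -> A `<=` P ->
  B `&` P `<=` A -> S `&` P = A.
Proof.
move=> -> AP BPA; apply/seteqP; split=> [x [[]// Bx Px]|x Ax]; first exact: BPA.
by split; [left|apply: AP].
Qed.

Lemma code_part_split_x u v :
  code_part (u, v) = code_part (rcons u false, v) `|` code_part (rcons u true, v).
Proof.
apply/seteqP; split=> [_ [[x y] [/= Cx Cy] <-]|].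
  have [b [x' [Cx' ->]]] := cantor_pop Cx; rewrite -triadic_rcons.
  by case: b; [right|left]; exists (x', y).
move=> _ [] [[x y] [/= Cx Cy] <-] /=; rewrite triadic_rcons.
  by exists (push false x, y) => //; split=> //; apply: cantor_push.
by exists (push true x, y) => //; split=> //; apply: cantor_push.
Qed.

Lemma code_part_split_y u v :
  code_part (u, v) = code_part (u, rcons v false) `|` code_part (u, rcons v true).
Proof.
apply/seteqP; split=> [_ [[x y] [/= Cx Cy] <-]|].
  have [b [y' [Cy' ->]]] := cantor_pop Cy; rewrite -triadic_rcons.
  by case: b; [right|left]; exists (x, y').
move=> _ [] [[x y] [/= Cx Cy] <-] /=; rewrite triadic_rcons.
  by exists (x, push false y) => //; split=> //; apply: cantor_push.
by exists (x, push true y) => //; split=> //; apply: cantor_push.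
Qed.

Lemma triadic_between u s t x :
  (triadic u 0 + s * (triadic u 1 - triadic u 0) <= triadic u x <=
   triadic u 0 + t * (triadic u 1 - triadic u 0)) = (s <= x <= t).
Proof.
have E y : triadic u 0 + y * (triadic u 1 - triadic u 0) = triadic u y.
  by rewrite [triadic u 1]triadicE [RHS]triadicE; ring.
by rewrite !E !triadic_le.
Qed.

Lemma pts_xpart c s t x y : cantor x -> cantor y ->
  pts (xpart s t (hull (code_part c))) (triadic c.1 x, triadic c.2 y) <->
  s <= x <= t.
Proof.
move=> Cx Cy; rewrite hull_code_part /pts /setX /= !in_itv /= triadic_between.
have /andP [y0 y1] := cantor01 Cy.
by split=> [[->]|-> ] //; split=> //; rewrite !triadic_le y0 y1.
Qed.

Lemma pts_ypart c s t x y : cantor x -> cantor y ->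
  pts (ypart s t (hull (code_part c))) (triadic c.1 x, triadic c.2 y) <->
  s <= y <= t.
Proof.
move=> Cx Cy; rewrite hull_code_part /pts /setX /= !in_itv /= triadic_between.
have /andP [x0 x1] := cantor01 Cx.
by split=> [[_ ->]|-> ] //; split=> //; rewrite !triadic_le x0 x1.
Qed.

Lemma code_part_left u v : code_part (rcons u false, v) =
  code_part (u, v) `&` pts (xpart 0 (1 / 3) (hull (code_part (u, v)))).
Proof.
apply/esym/(part_cut (code_part_split_x u v)).
  move=> _ [[x y] [/= Cx Cy] <-]; rewrite triadic_rcons.
  apply/(@pts_xpart (u, v)) => //; first exact: cantor_push.
  by have := cantor01 Cx; rewrite /push; lra.
move=> _ [[[x y] [/= Cx Cy] <-]]; rewrite triadic_rcons.
move=> /(pts_xpart (u, v) _ _ (cantor_push true Cx) Cy).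
by have := cantor01 Cx; rewrite /push; lra.
Qed.

Lemma code_part_right u v : code_part (rcons u true, v) =
  code_part (u, v) `&` pts (xpart (2 / 3) 1 (hull (code_part (u, v)))).
Proof.
apply/esym/(part_cut (etrans (code_part_split_x u v) (setUC _ _))).
  move=> _ [[x y] [/= Cx Cy] <-]; rewrite triadic_rcons.
  apply/(@pts_xpart (u, v)) => //; first exact: cantor_push.
  by have := cantor01 Cx; rewrite /push; lra.
move=> _ [[[x y] [/= Cx Cy] <-]]; rewrite triadic_rcons.
move=> /(pts_xpart (u, v) _ _ (cantor_push false Cx) Cy).
by have := cantor01 Cx; rewrite /push; lra.
Qed.

Lemma code_part_bottom u v : code_part (u, rcons v false) =
  code_part (u, v) `&` pts (ypart 0 (1 / 3) (hull (code_part (u, v)))).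
Proof.
apply/esym/(part_cut (code_part_split_y u v)).
  move=> _ [[x y] [/= Cx Cy] <-]; rewrite triadic_rcons.
  apply/(@pts_ypart (u, v)) => //; first exact: cantor_push.
  by have := cantor01 Cy; rewrite /push; lra.
move=> _ [[[x y] [/= Cx Cy] <-]]; rewrite triadic_rcons.
move=> /(pts_ypart (u, v) _ _ Cx (cantor_push true Cy)).
by have := cantor01 Cy; rewrite /push; lra.
Qed.

Lemma code_part_top u v : code_part (u, rcons v true) =
  code_part (u, v) `&` pts (ypart (2 / 3) 1 (hull (code_part (u, v)))).
Proof.
apply/esym/(part_cut (etrans (code_part_split_y u v) (setUC _ _))).
  move=> _ [[x y] [/= Cx Cy] <-]; rewrite triadic_rcons.
  apply/(@pts_ypart (u, v)) => //; first exact: cantor_push.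
  by have := cantor01 Cy; rewrite /push; lra.
move=> _ [[[x y] [/= Cx Cy] <-]]; rewrite triadic_rcons.
move=> /(pts_ypart (u, v) _ _ Cx (cantor_push false Cy)).
by have := cantor01 Cy; rewrite /push; lra.
Qed.

(** The vertical cuts are made first; any order leads to the same set. *)
Lemma cantor_part_code c : cantor_part (code_rect c) (code_part c).
Proof.
case: c => u v; elim/last_ind: v => [|v b IH]; last first.
  case: b; first by rewrite code_rect_top code_part_top; constructor.
  by rewrite code_rect_bottom code_part_bottom; constructor.
elim/last_ind: u => [|u b IH]; last first.
  case: b; first by rewrite code_rect_right code_part_right; constructor.
  by rewrite code_rect_left code_part_left; constructor.
suff -> : code_part ([::], [::]) = @cantor_sq R by constructor.
apply/seteqP; split=> [_ [[x y] Cxy <-]//|[x y] Cxy]; by exists (x, y).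
Qed.

End Geometry.

Section Patterns.

Definition root : code := ([::], [::]).
Definition kid (vertical b : bool) c : code :=
  if vertical then (rcons c.1 b, c.2) else (c.1, rcons c.2 b).

(** The exact tiling guarantees that the rectangles listed are distinct, so that
    removing one of them from the set, as a step of [pattern] does, is removing
    it from the list. *)
Definition subdivision (s : seq code) :=
  (forall p, count (covers p) s = 1) /\
  pattern [set code_rect c | c in [set` s]].

Lemma subdivision_root : subdivision [:: root].
Proof.
split=> //; suff -> : [set code_rect c | c in [set` [:: root]]] = [set unit_square R].
  by constructor.
by rewrite -[RHS](image_set1 code_rect root); congr image; apply/seteqP; split=> x /=; rewrite inE => /eqP.
Qed.

Lemma subdivision_perm s t : perm_eq s t -> subdivision s -> subdivision t.
Proof.
move=> st [cov pat]; split=> [p|]; first by rewrite -(seq.permP st).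
suff <- : [set` s] = [set` t] by [].
by apply/seteqP; split=> c /=; rewrite (perm_mem st).
Qed.

(** A box listed twice would cover its points twice. *)
Lemma subdivision_uniq s : subdivision s -> uniq s.
Proof.
move=> [cov _]; apply: count_mem_uniq => c.
have [cs|/negbTE cs] := boolP (c \in s); last by apply/count_memPn; rewrite cs.
apply/eqP; rewrite eqn_leq andbC -has_count has_pred1 cs /=.
have x0 : K := cpoint (cantor0 R).
rewrite -(cov (box c (x0, x0))); apply: sub_count => d /eqP ->.
by apply/coversP; exists (x0, x0).
Qed.

Lemma covers_kid p vertical c :
  covers p c = covers p (kid vertical false c) + covers p (kid vertical true c) :> nat.
Proof.
rewrite /covers; case: vertical; rewrite /= !size_rcons !digitsS !eqseq_rcons.
  by case: (chead _); case: (digits _ _ == c.1); case: (digits _ _ == c.2).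
by case: (chead _); case: (digits _ _ == c.1); case: (digits _ _ == c.2).
Qed.

Lemma subdivision_split vertical c s : subdivision (c :: s) ->
  subdivision (kid vertical false c :: kid vertical true c :: s).
Proof.
move=> sub; have /= /andP [cs _] := subdivision_uniq sub; case: sub => cov pat.
split=> [p|]; first by rewrite -(cov p) /= (covers_kid p vertical c) addnA.
set P := image _ _ in pat.
have Pc : P (code_rect c) by exists c => //=; rewrite inE eqxx.
have E : [set code_rect d | d in [set` kid vertical false c :: kid vertical true c :: s]] =
   (P `\ code_rect c) `|` [set code_rect (kid vertical false c); code_rect (kid vertical true c)].
  apply/seteqP; split=> [q [d /=]|q].
    rewrite !inE => /or3P [/eqP ->|/eqP ->|ds] <-; [by right; left|by right; right|left].
    split; first by exists d => //=; rewrite inE ds orbT.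
    by move=> /= /code_rect_inj E; rewrite -E ds in cs.
  case=> [[[d /=]]|[]->].
  - rewrite inE => /predU1P [-> <- //|ds <- _].
    by exists d => //=; rewrite !inE ds !orbT.
  - by exists (kid vertical false c) => //=; rewrite !inE eqxx.
  - by exists (kid vertical true c) => //=; rewrite !inE eqxx orbT.
rewrite {}E; clear cov cs; clearbody P; case: c Pc => u v Pc; case: vertical => /=.
  by rewrite code_rect_left code_rect_right; constructor.
by rewrite code_rect_bottom code_rect_top; constructor.
Qed.

Fixpoint column l c : seq code :=
  if l is l'.+1 then column l' (kid false false c) ++ column l' (kid false true c)
  else [:: c].

Fixpoint grid k l c : seq code :=
  if k is k'.+1 then grid k' l (kid true false c) ++ grid k' l (kid true true c)
  else column l c.

(** Refining both halves of [c] by the same procedure [F]; the order of the list is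
    immaterial. *)
Lemma subdivision_twice (F : code -> seq code) vertical c s :
  (forall d t, subdivision (d :: t) -> subdivision (F d ++ t)) ->
  subdivision (c :: s) ->
  subdivision ((F (kid vertical false c) ++ F (kid vertical true c)) ++ s).
Proof.
move=> Fsub /(subdivision_split vertical) /Fsub sub.
rewrite -catA; apply: (@subdivision_perm (F (kid vertical true c) ++ F (kid vertical false c) ++ s)).
  by rewrite perm_catCA.
by apply: Fsub; apply: subdivision_perm sub; rewrite -cat1s perm_catCA.
Qed.

Lemma subdivision_column l c s : subdivision (c :: s) -> subdivision (column l c ++ s).
Proof. by elim: l c s => // l IH c s; apply: (subdivision_twice (F := column l)). Qed.

Lemma subdivision_grid k l c s : subdivision (c :: s) -> subdivision (grid k l c ++ s).
Proof.
elim: k c s => [|k IH] c s; first exact: subdivision_column.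
exact: (subdivision_twice (F := grid k l)).
Qed.

Lemma subdivision_grids (k l : code -> nat) s : subdivision s ->
  subdivision (flatten [seq grid (k c) (l c) c | c <- s]).
Proof.
rewrite -[flatten _]cats0 -{1}[s]cats0; elim: s [::] => //= c s IH t sub.
rewrite -catA; apply: (@subdivision_perm (flatten [seq grid (k c) (l c) c | c <- s] ++ grid (k c) (l c) c ++ t)).
  by rewrite perm_catCA.
apply: IH; apply: (@subdivision_perm (grid (k c) (l c) c ++ s ++ t)).
  by rewrite perm_catCA.
exact: subdivision_grid.
Qed.

Lemma mem_column l c d :
  d \in column l c -> exists2 w, d = cext c ([::], w) & size w = l.
Proof.
elim: l c => [|l IH] c /=.
  by rewrite inE => /eqP ->; exists [::]; rewrite ?cext0.
rewrite mem_cat => /orP [] /IH [w -> <-].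
  by exists (false :: w) => //; rewrite /cext /= !cats0 cat_rcons.
by exists (true :: w) => //; rewrite /cext /= !cats0 cat_rcons.
Qed.

Lemma mem_grid k l c d : d \in grid k l c -> exists2 e, d = cext c e & sizes e = (k, l).
Proof.
elim: k c => [|k IH] c /=.
  by move=> /mem_column [w -> wl]; exists ([::], w); rewrite /sizes ?wl.
rewrite mem_cat => /orP [] /IH [[w v] -> [<- <-]].
  by exists (false :: w, v) => //; rewrite /cext /= cat_rcons.
by exists (true :: w, v) => //; rewrite /cext /= cat_rcons.
Qed.

Lemma grid_root k l c : (c \in grid k l root) = (sizes c == (k, l)).
Proof.
apply/idP/eqP => [/mem_grid [e -> <-] //|sc].
have x0 : K := cpoint (cantor0 R).
have [cov _] : subdivision (grid k l root).
  by rewrite -[grid _ _ _]cats0; apply: subdivision_grid; apply: subdivision_root.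
have : has (covers (box c (x0, x0))) (grid k l root) by rewrite has_count cov.
case/hasP => d dg /coversP [q eq]; suff -> : c = d by [].
apply: box_inj_sizes eq; rewrite sc.
by have [e -> <-] := mem_grid dg.
Qed.

Lemma numbered_subdivision s m : size s = m -> subdivision s ->
  numbered_pattern (fun i : 'I_m => code_rect (nth root s i)).
Proof.
move=> <- {m} sub; split=> [i j /code_rect_inj /eqP|].
  by rewrite nth_uniq ?subdivision_uniq // => /eqP /val_inj.
case: sub => _; congr pattern; apply/seteqP; split=> [_ [c /= /(nthP root) [i si <-] <-]|_ [i _ <-]].
  by exists (Ordinal si).
by exists (nth root s i) => //=; apply: mem_nth.
Qed.

Lemma val_wpush u (x : K) : val (wpush u x) = triadic u (val x).
Proof. by elim: u => //= b u ->. Qed.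

Lemma triadic_scale u v : exists a (j : int), forall x,
  (a + 3 ^ j * triadic u x = triadic v x)%R.
Proof.
pose j := ((size u)%:Z - (size v)%:Z)%R.
exists (triadic v 0 - 3 ^ j * triadic u 0)%R, j => x.
rewrite (triadicE u x) (triadicE v x) mulrDr mulrA.
suff -> : (3 ^ j * 3^-1 ^+ size u = 3^-1 ^+ size v :> R)%R by ring.
have n3 : (3 : R)%R != 0%R by rewrite pnatr_eq0.
rewrite /j expfzDr // -exprnP exprVn mulrAC mulfV ?mul1r ?expf_neq0 //.
by rewrite exprVn exprnN.
Qed.

Lemma triadic_map_code c d : exists a b j k, forall x y,
  triadic_map a b j k (triadic c.1 x, triadic c.2 y) = (triadic d.1 x, triadic d.2 y).
Proof.
have [a [j aj]] := triadic_scale c.1 d.1; have [b [k bk]] := triadic_scale c.2 d.2.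
by exists a, b, j, k => x y; rewrite /triadic_map /= aj bk.
Qed.

(** The images of the cells of a uniform grid need not form a pattern: a tiling by
    dyadic rectangles need not arise by successive cuts.  But if [E] bounds the
    lengths of the words of these images, then cutting each cell uniformly so
    that its image is cut down to length [E] in both directions gives a pattern
    [dom], obtained by refining a grid, whose image is the uniform grid of depth
    [E], again a pattern. *)
Lemma box_local_twoV f : box_local f -> twoV R f.
Proof.
move=> [D fD].
have /choice [phi phiP] : forall c, exists d, D <= size c.1 -> D <= size c.2 -> moves f c d.
  move=> c; have [D1|] := boolP (D <= size c.1); last by exists root.
  have [D2|] := boolP (D <= size c.2); last by exists root.
  by have [d fd] := fD c D1 D2; exists d.
pose cells := grid D D root.
pose E := \max_(c <- cells) maxn (size (phi c).1) (size (phi c).2).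
pose dom := flatten [seq grid (E - size (phi c).1) (E - size (phi c).2) c | c <- cells].
have sub : subdivision dom.
  apply: subdivision_grids; rewrite -[cells]cats0.
  by apply: subdivision_grid; apply: subdivision_root.
have domP d : d \in dom -> moves f d (phi d) /\ sizes (phi d) = (E, E).
  move=> /flatten_mapP [c cc /mem_grid [e dE [e1 e2]]].
  have /eqP [c1 c2] : sizes c == (D, D) by rewrite -grid_root.
  have fc : moves f c (phi c) by apply: phiP; rewrite ?c1 ?c2.
  have fd : moves f d (phi d).
    by apply: phiP; rewrite dE size_cat ?c1 ?c2 leq_addr.
  split=> //; have -> : phi d = cext (phi c) e.
    by apply: moves_inj fd _; rewrite dE; apply: moves_cext.
  have : maxn (size (phi c).1) (size (phi c).2) <= E.
    exact: (leq_bigmax_seq (F := fun c => maxn (size (phi c).1) (size (phi c).2))).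
  by rewrite geq_max => /andP [? ?]; rewrite sizes_cext e1 e2 !subnKC.
have phi_inj : {in dom &, injective phi}.
  move=> c d /domP [fc _] /domP [fd _] eq; apply: box_inj => p.
  by apply: (can_inj of_pairK); apply: (can_inj (@sbfunK _ f)); rewrite fc fd eq.
have uniq_dom := subdivision_uniq sub.
have uniq_ran : uniq (map phi dom) by rewrite map_inj_in_uniq.
have ranE : map phi dom =i grid E E root.
  move=> e; rewrite grid_root; apply/mapP/eqP => [[d /domP [_ <-] ->] //|eE].
  have x0 : K := cpoint (cantor0 R).
  pose x := of_pair (box e (x0, x0)).
  have : has (covers (to_pair (sbinv f x))) dom by rewrite has_count (proj1 sub).
  case/hasP => d dd /coversP [q qE]; exists d => //.
  have [fd dE] := domP d dd; apply: (@box_inj_sizes _ _ (x0, x0) q); first by rewrite eE dE.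
  by apply: (can_inj of_pairK); rewrite -fd -qE to_pairK sbinvK.
have subran : subdivision (map phi dom).
  apply: (@subdivision_perm (grid E E root)).
    apply: uniq_perm => //; apply: subdivision_uniq.
    rewrite -[grid _ _ _]cats0; apply: subdivision_grid; exact: subdivision_root.
  by rewrite -[grid _ _ _]cats0; apply: subdivision_grid; apply: subdivision_root.
exists (size dom), (fun i => code_rect (nth root dom i)).
exists (fun i => code_rect (nth root (map phi dom) i)); split.
- exact: numbered_subdivision.
- by apply: numbered_subdivision; rewrite ?size_map.
move=> i; set c := nth root dom i.
have [fc _] : moves f c (phi c) /\ _ := domP c (mem_nth _ (ltn_ord i)).
have [a [b [j [k abjk]]]] := triadic_map_code c (phi c).
exists (code_part c), (code_part (phi c)), a, b, j, k; split.
- exact: cantor_part_code.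
- by rewrite (nth_map root) //; apply: cantor_part_code.
- apply/seteqP; split=> [_ [_ [[x y] Cxy <-] <-]|_ [[x y] Cxy <-]].
    by exists (x, y) => //; rewrite abjk.
  by exists (triadic c.1 x, triadic c.2 y) => //; exists (x, y).
move=> p [[x y] [/= Cx Cy] pE]; rewrite -pE abjk.
have -> : p = of_pair (box c (cpoint Cx, cpoint Cy)).
  by apply: val_inj; rewrite /= !val_wpush -pE.
by rewrite fc /= !val_wpush.
Qed.

End Patterns.

(** * The bouncing head *)

Definition pair_bij (F F' : K * K -> K * K) (FK : cancel F F') (F'K : cancel F' F) :
  selfbij X.
Proof.
by refine (@SelfBij X (of_pair \o F \o to_pair) (of_pair \o F' \o to_pair) _ _) => x /=;
  rewrite of_pairK ?FK ?F'K to_pairK.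
Defined.

Lemma pair_bijE F F' FK F'K p : @pair_bij F F' FK F'K (of_pair p) = of_pair (F p).
Proof. by rewrite /= of_pairK. Qed.

(** A machine with two states on a two-sided tape.  The first digit of [x] is the
    state, 0 moving right and 1 moving left; the rest of [x] is the tape to the
    left of the head, read leftwards, and [y] is the tape to its right.  The
    head passes over zeros and turns at ones. *)
Definition bounce p : K * K :=
  let: (x, y) := p in let x' := ctail x in
  if chead x then
    if chead x' then (cpush false x', y) else (cpush true (ctail x'), cpush false y)
  else
    if chead y then (cpush true x', y) else (cpush false x, ctail y).

Definition unbounce p : K * K :=
  let: (x, y) := p in let x' := ctail x in
  if chead x then
    if chead y then (cpush false x', y) else (cpush true (cpush false x'), ctail y)
  else
    if chead x' then (cpush true x', y) else (x', cpush false y).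

Lemma cpush2P (x : K) : exists a b z, x = cpush a (cpush b z).
Proof. by exists (chead x), (chead (ctail x)), (ctail (ctail x)); rewrite !cpushK. Qed.

Lemma bounceK : cancel bounce unbounce.
Proof.
case=> x y; have [a [b [x' ->]]] := cpush2P x; have [d [e [y' ->]]] := cpush2P y.
by rewrite /bounce /unbounce; case: a; case: b; case: d;
  rewrite !(chead_cpush, ctail_cpush).
Qed.

Lemma unbounceK : cancel unbounce bounce.
Proof.
case=> x y; have [a [b [x' ->]]] := cpush2P x; have [d [e [y' ->]]] := cpush2P y.
by rewrite /bounce /unbounce; case: a; case: b; case: d;
  rewrite !(chead_cpush, ctail_cpush).
Qed.

Definition head_map := pair_bij bounceK unbounceK.

Lemma head_map_local : box_local head_map.
Proof.
exists 2 => -[[|a [|b u]] [|e v]] // _ _.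
pose d : code :=
  if a then if b then (false :: true :: u, e :: v) else (true :: u, false :: e :: v)
  else if e then (true :: b :: u, true :: v) else (false :: false :: b :: u, v).
exists d => -[x y]; rewrite pair_bijE /d {d}; congr of_pair.
by case: a; case: b; case: e; rewrite /= !(chead_cpush, ctail_cpush).
Qed.

Lemma iter_head_map k p : iter k head_map (of_pair p) = of_pair (iter k bounce p).
Proof. by elim: k => // k IH; rewrite !iterS IH pair_bijE. Qed.

Lemma bounce_right k x y :
  iter k bounce (cpush false x, wpush (nseq k false) y) =
  (cpush false (wpush (nseq k false) x), y).
Proof.
elim: k x => // k IH x; rewrite iterSr [bounce _]/= !(chead_cpush, ctail_cpush).
rewrite IH; congr (cpush _ _, _); rewrite -[cpush false x]/(wpush [:: false] x) -wpush_cat.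
by rewrite -(nseqD k 1) addn1.
Qed.

Lemma bounce_left k x y :
  iter k bounce (cpush true (wpush (nseq k false) x), y) =
  (cpush true x, wpush (nseq k false) y).
Proof.
elim: k y => // k IH y; rewrite iterSr [bounce _]/= !(chead_cpush, ctail_cpush).
rewrite IH; congr (_, _); rewrite -[cpush false y]/(wpush [:: false] y) -wpush_cat.
by rewrite -(nseqD k 1) addn1.
Qed.

(** The head, moving right, stands just after a one, and [k] zeros followed by a one
    lie ahead. *)
Definition cage k : code := ([:: false; true], rcons (nseq k false) true).

(** [k] steps to reach the far end, and one to turn. *)
Lemma bounce_half_turn k x y : iter k.+1 bounce (box (cage k) (x, y)) =
  (cpush true (wpush (nseq k false) (cpush true x)), cpush true y).
Proof.
rewrite iterS /box /= -cats1 wpush_cat bounce_right /=.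
by rewrite !(chead_cpush, ctail_cpush).
Qed.

Lemma bounce_turn k p : iter (2 * k.+1) bounce (box (cage k) p) = box (cage k) p.
Proof.
case: p => x y; rewrite mul2n -addnn iterD bounce_half_turn iterS bounce_left.
rewrite /= !(chead_cpush, ctail_cpush) /box /= -cats1 wpush_cat.
by [].
Qed.

(** Changes the first digit of [x] that the box [c] leaves free, so that [flip c] is
    an involution moving every point of that box and no other point. *)
Definition flip c p : K * K :=
  if covers p c then
    let x := iter (size c.1) (@ctail R) p.1 in
    (wpush c.1 (cpush (~~ chead x) (ctail x)), p.2)
  else p.

Lemma flip_box c x y b :
  flip c (box c (cpush b x, y)) = box c (cpush (~~ b) x, y).
Proof.
rewrite /flip; have -> : covers (box c (cpush b x, y)) c by apply/coversP; eexists.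
by rewrite /= tail_wpush chead_cpush ctail_cpush.
Qed.

Lemma flip_out c p : ~~ covers p c -> flip c p = p.
Proof. by rewrite /flip => /negbTE ->. Qed.

Lemma covers_flip c p : covers (flip c p) c = covers p c.
Proof.
have [/coversP [[x y] ->]|pc] := boolP (covers p c); last by rewrite flip_out // (negbTE pc).
by rewrite -(cpushK x) flip_box; apply/coversP; eexists.
Qed.

Lemma flipK c : involutive (flip c).
Proof.
move=> p; have [/coversP [[x y] ->]|pc] := boolP (covers p c); last by rewrite !flip_out.
by rewrite -(cpushK x) !flip_box negbK.
Qed.

Definition flip_map c := pair_bij (flipK c) (flipK c).

Lemma flip_mapE c p : flip_map c (of_pair p) = of_pair (flip c p).
Proof. exact: pair_bijE. Qed.

(** A box with longer words than [c] on both sides is either contained in [c] or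
    disjoint from it. *)
Lemma flip_map_local c : box_local (flip_map c).
Proof.
exists (size c.1 + size c.2).+1 => e e1 e2.
have [ec|ec] := boolP ((take (size c.1) e.1 == c.1) && (take (size c.2) e.2 == c.2)).
  case/andP: ec => /eqP c1 /eqP c2.
  case d1 : (drop (size c.1) e.1) => [|b w].
    by move/(congr1 size): d1; rewrite size_drop /=; lia.
  have eE : e = cext c (b :: w, drop (size c.2) e.2).
    by rewrite /cext -d1 -{1}c1 -{2}c2 !cat_take_drop; case: (e).
  exists (cext c (~~ b :: w, drop (size c.2) e.2)) => -[x y].
  by rewrite pair_bijE {1}eE !box_cext flip_box.
exists e => p; rewrite pair_bijE flip_out //; apply: contra ec => /coversP [q].
move=> [E1 E2]; rewrite -(cat_take_drop (size c.1) e.1) wpush_cat in E1.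
rewrite -(cat_take_drop (size c.2) e.2) wpush_cat in E2.
have [] := wpush_inj_size _ E1; first by rewrite size_takel //; lia.
have [] := wpush_inj_size _ E2; first by rewrite size_takel //; lia.
by move=> -> _ -> _; rewrite !eqxx.
Qed.

(** The power of [head_map] is the identity on the box [cage k], hence preserves its
    complement, where the flip is the identity. *)
Lemma head_map_flip k :
  (flip_map (cage k) * head_map ^+ (2 * k.+1) =
   head_map ^+ (2 * k.+1) * flip_map (cage k))%g.
Proof.
apply: selfbijP => x; rewrite -(to_pairK x); move: (to_pair x) => {x} p.
rewrite !sb_mulE !sb_expE (flip_mapE _ p) !iter_head_map flip_mapE; congr of_pair.
set G := iter _ bounce.
have G_inj : injective G.
  by rewrite /G; elim: (2 * k.+1) => // m IH q q' /(can_inj bounceK) /IH.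
have Gcage q : covers q (cage k) -> G q = q by case/coversP => q' ->; apply: bounce_turn.
have [pc|pc] := boolP (covers p (cage k)).
  by rewrite !Gcage ?covers_flip.
rewrite (flip_out pc) flip_out //; apply: contra pc => Gpc.
by rewrite (G_inj p (G p)) ?(Gcage _ Gpc).
Qed.

(** After half a period a head started in the box [cage k] is in the other state, so
    it is outside the box, where the flip does nothing. *)
Lemma head_map_flip_half k :
  (flip_map (cage k) * head_map ^+ k.+1 <> head_map ^+ k.+1 * flip_map (cage k))%g.
Proof.
pose z := cpoint (cantor0 R); pose p b := box (cage k) (cpush b z, z).
move=> /(congr1 (fun f : selfbij X => f (of_pair (p true)))).
rewrite !sb_mulE !sb_expE (flip_mapE _ (p true)) !iter_head_map flip_mapE.
move=> /(can_inj of_pairK); rewrite flip_box flip_out.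
  rewrite !bounce_half_turn => /(congr1 fst) /cpush_inj [_].
  by move=> /(wpush_inj_size (erefl _)) [_] /cpush_inj [_] /cpush_inj [].
rewrite bounce_half_turn; apply/negP => /andP [] /=.
by rewrite chead_cpush.
Qed.

End CantorSquare.

(** * The groups are not isomorphic *)

(** An isomorphism onto [B] would carry the power [N] provided by
    [prefix_local_commute] for the image of [head_map] back to 2V, against
    [head_map_flip] and [head_map_flip_half] for [k = N - 1]. *)
Lemma twoV_not_isomorphic (R : realType) n r (B : set (selfbij (cantor_copies n r))) :
  1 < n -> (B `<=` @prefix_local n r)%classic -> ~ isomorphic (twoV R) B.
Proof.
move=> n_gt1 BV [phi [[phiB phi_inj _] phiM]].
pose g := head_map R.
have gX k : twoV R (g ^+ k)%g.
  by apply: box_local_twoV; apply: box_localX; apply: head_map_local.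
have phiX k : phi (g ^+ k.+1)%g = (phi g ^+ k.+1)%g.
  elim: k => [|k IH]; first by rewrite !expg1.
  by rewrite expgS phiM ?IH -?expgS //; apply: (gX 1).
have phig : prefix_local (phi g) by apply/BV/phiB/(gX 1).
have [[//|k] _ comm] := prefix_local_commute n_gt1 phig.
pose h := flip_map R (cage k).
have hV : twoV R h by apply: box_local_twoV; apply: flip_map_local.
have hgX m : twoV R (h * g ^+ m)%g.
  apply: box_local_twoV; apply: box_localM; first exact: flip_map_local.
  by apply: box_localX; apply: head_map_local.
have gXh m : twoV R (g ^+ m * h)%g.
  apply: box_local_twoV; apply: box_localM; last exact: flip_map_local.
  by apply: box_localX; apply: head_map_local.
have eq2 : (phi h * phi g ^+ (2 * k.+1) = phi g ^+ (2 * k.+1) * phi h)%g.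
  have := head_map_flip R k; have -> : 2 * k.+1 = (2 * k).+2 by lia.
  rewrite -/g -/h => /(congr1 phi).
  by rewrite (phiM h) // (phiM _ h) // phiX.
have := comm (phi h) (BV _ (phiB _ hV)) eq2.
rewrite -phiX -(phiM h) // -(phiM _ h) // => /phi_inj eq.
by apply: (@head_map_flip_half R k); apply: eq; rewrite inE.
Qed.

Unset Implicit Arguments.

Theorem theorem3 (R : realType) (n r : nat) (hn : (2 <= n)%N) (hr : (1 <= r)%N) :
  ~ isomorphic (twoV R) (Vplus n r) /\ ~ isomorphic (twoV R) (Ts n r).
Proof.
have V_local := HigmanV_prefix_local hn (r := r).
have grp := @prefix_local_group n r.
split; apply: twoV_not_isomorphic => //; apply: (derived_sub grp) => //.
apply: (derived_sub grp) => f [m [P [Q [sigma [pP pQ _ fPQ]]]]].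
by apply: V_local; exists m, P, Q, sigma.
Qed.
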